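(* Let $d$ be a prime and let $n\ge 1$ be an integer. Let $C'(n,d)$ be the group of invertible $n\times n$ circulant matrices $g$ over $\mathbb{F}_d$ with $g\mathbf{1}=\mathbf{1}$, and let $Q_n$ be the $n\times n$ permutation matrix of the cyclic permutation $(1,2,\ldots,n)$. Then $$S(n,d)\cong C'(n,d)/\langle Q_n\rangle\qquad\text{and}\qquad \Sigma(n,d)\cong C'(n,d),$$ where $S(n,d)$ is the sandpile group (equivalently, critical group) and $\Sigma(n,d)$ is the sand dune group of the generalized de Bruijn graph $\mathrm{DB}(n,d)$.
   Context: An $n\times n$ circulant matrix over a field $F$ is a matrix of the form $a_1Q_n+a_2Q_n^2+\cdots+a_nQ_n^n$ with $a_i\in F$. The invertible circulant matrices over $\mathbb{F}_d$ form a commutative group $C(n,d)$ under multiplication (the centralizer of $Q_n$ in $\mathrm{GL}_n(\mathbb{F}_d)$); $\mathbf{1}=(1,\ldots,1)^\top$ is an eigenvector of each of them, and $C'(n,d)=\{g\in C(n,d) : g\mathbf{1}=\mathbf{1}\}$. The generalized de Bruijn graph $\mathrm{DB}(n,d)$ is the directed multigraph with vertex set $\mathbb{Z}_n$ (integers modulo $n$) and directed edges $v\to dv+i$ for $i=0,\ldots,d-1$ and all $v\in\mathbb{Z}_n$ (counted with multiplicity, loops allowed). The Laplacian of a directed multigraph is $\Delta=D-A$, where $A_{v,w}$ is the number of edges from $v$ to $w$ and $D$ is diagonal with $D_{v,v}$ the indegree of $v$; the critical group is the finite part (torsion subgroup) of $\mathbb{Z}^n$ modulo the $\mathbb{Z}$-span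 of the rows of $\Delta$. For the Eulerian digraph $\mathrm{DB}(n,d)$ it coincides with the sandpile group at any vertex, and is denoted $S(n,d)$. Let $\mathcal{Z}_n=\{a(x)\in\mathbb{Z}[x]/(x^n-1) : a(1)=0\}$ and $f_v(x)=d x^v-x^{dv}\sum_{i=0}^{d-1}x^i$ for $v\in\mathbb{Z}_n$. Then $S(n,d)=\mathcal{Z}_n/\langle f_v : v\in\mathbb{Z}_n\setminus\{0\}\rangle_{\mathbb{Z}}$. The sand dune group is $\Sigma(n,d)=\mathcal{Z}_n/\langle (x-1)f_v : v\in\mathbb{Z}_n\setminus\{0\}\rangle_{\mathbb{Z}}$; equivalently, with $e_v=x^v-1$, $\Sigma(n,d)=\mathcal{Z}_n/\langle d e_v-e_{dv} : v\in\mathbb{Z}_n\setminus\{0\}\rangle_{\mathbb{Z}}$. *)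

(* Defs.v *)
From HB Require Import structures.
From mathcomp Require Import all_boot all_order all_fingroup all_algebra.
From mathcomp Require Import generic_quotient ring_quotient qpoly boolp.

Set Implicit Arguments.
Unset Strict Implicit.
Unset Printing Implicit Defensive.

Import GRing.Theory.
Import Quotient.Exports.

Local Open Scope ring_scope.

(* Isomorphism of an additive group onto a subset of a (multiplicative) finite
   group; such a subset is then necessarily a subgroup. *)
Definition zmod_isog (V : zmodType) (gT : finGroupType) (G : {set gT}) : Prop :=
  exists f : V -> gT,
    [/\ injective f,
        forall x y : V, f (x + y) = (f x * f y)%g
      & forall g : gT, g \in G <-> exists x : V, f x = g].

Section Zmodules.
Variable V : zmodType.

Definition int_span (s : seq V) : {pred V} :=
  fun v => `[< inIntSpan (in_tuple s) v >].

Fact int_span_zmod_closed (s : seq V) : zmod_closed (int_span s).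
Proof.
split=> [|u v /asboolP[a ->] /asboolP[b ->]]; apply/asboolP.
  by exists [ffun => 0]; rewrite big1 // => i _; rewrite ffunE mulr0z.
exists [ffun i => a i - b i]; rewrite -sumrB.
by apply: eq_bigr => i _; rewrite ffunE mulrzBr.
Qed.

HB.instance Definition _ (s : seq V) :=
  GRing.isZmodClosed.Build V (int_span s) (int_span_zmod_closed s).

(* V modulo the subgroup generated by the elements of [s]. *)
Definition zquot (s : seq V) : zmodType := Quotient.quot (int_span s).

Definition tors : {pred V} := fun v => `[< exists2 m, (0 < m)%N & v *+ m = 0 >].

Fact tors_zmod_closed : zmod_closed tors.
Proof.
split=> [|u v /asboolP[a a0 ua] /asboolP[b b0 vb]]; apply/asboolP.
  by exists 1%N.
exists (a * b)%N; first by rewrite muln_gt0 a0.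
by rewrite mulrnBl mulrnA ua mul0rn mulnC mulrnA vb mul0rn subrr.
Qed.

HB.instance Definition _ := GRing.isZmodClosed.Build V tors tors_zmod_closed.

Definition torsion_subgroup : Type := {v : V | v \in tors}.
HB.instance Definition _ := SubChoice.on torsion_subgroup.
HB.instance Definition _ := [SubChoice_isSubZmodule of torsion_subgroup by <:].

End Zmodules.

Record multidigraph (n : nat) := Multidigraph {
  edge : finType;
  src : edge -> 'I_n;
  tgt : edge -> 'I_n
}.

Definition adjacency n (G : multidigraph n) : 'M[int]_n :=
  \matrix_(v, w) #|[set e : edge G | (src e == v) && (tgt e == w)]|%:Z.

Definition indegree n (G : multidigraph n) (v : 'I_n) : nat :=
  #|[set e : edge G | tgt e == v]|.

Definition laplacian n (G : multidigraph n) : 'M[int]_n :=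
  diag_mx (\row_v (indegree G v)%:Z) - adjacency G.

Definition critical_group n (G : multidigraph n) : zmodType :=
  torsion_subgroup (zquot [seq row v (laplacian G) | v : 'I_n]).

Section DeBruijn.
Variables n d : nat.

Fact ord_gt0 (v : 'I_n) : (0 < n)%N.
Proof. exact: leq_ltn_trans (leq0n v) (ltn_ord v). Qed.

Definition DB : multidigraph n :=
  @Multidigraph n ('I_n * 'I_d)%type (fun e => e.1)
    (fun e => Ordinal (ltn_pmod (d * e.1 + e.2) (ord_gt0 e.1))).

Definition sandpile_group : zmodType := critical_group DB.

(* Z[x]/(x^n - 1) for n > 0, each class being represented by its element of
   degree < n; evaluation at 1 does not depend on the representative, see
   [eval1_in_qpoly]. *)
Definition cycring : comNzRingType := {poly %/ ('X^n - 1 : {poly int})}.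

Definition eval1 (a : cycring) : int := (val a : {poly int}).[1].

Definition aug : {pred cycring} := fun a => eval1 a == 0.

Fact aug_zmod_closed : zmod_closed aug.
Proof.
rewrite /aug /eval1; split=> [|u v]; rewrite !unfold_in ?horner0 //.
by move=> /eqP u0 /eqP v0; rewrite /= hornerD hornerN u0 v0 subrr.
Qed.

HB.instance Definition _ := GRing.isZmodClosed.Build cycring aug aug_zmod_closed.

Definition augZ : Type := {a : cycring | a \in aug}.
HB.instance Definition _ := SubChoice.on augZ.
HB.instance Definition _ := [SubChoice_isSubZmodule of augZ by <:].

(* The class of x; cx ^+ n = 1 for n > 0, so exponents are read modulo n. *)
Definition cx : cycring := in_qpoly ('X^n - 1) 'X.

Definition fv (v : 'I_n) : cycring :=
  cx ^+ v *+ d - cx ^+ (d * v) * \sum_(i < d) cx ^+ i.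

Fact eval1_in_qpoly (p : {poly int}) :
  (0 < n)%N -> eval1 (in_qpoly ('X^n - 1) p) = p.[1].
Proof.
move=> n0; have mX : mk_monic ('X^n - 1 : {poly int}) = 'X^n - 1.
  by rewrite /mk_monic size_XnsubC // ltnS n0 monicXnsubC.
rewrite /eval1 /= mX.
rewrite [in RHS](Pdiv.RingMonic.rdivp_eq (monicXnsubC 1 n0) p).
by rewrite hornerD hornerM !hornerE expr1n subrr mulr0 add0r.
Qed.

Fact dune_gen_aug (v : 'I_n) : (cx - 1) * fv v \in aug.
Proof.
have n0 := ord_gt0 v; rewrite unfold_in.
have -> : (cx - 1) * fv v
    = in_qpoly ('X^n - 1) (('X - 1) * (val (fv v) : {poly int})).
  rewrite in_qpolyM rmorphB rmorph1; congr (_ * _).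
  by apply/val_inj/esym/in_qpoly_small/size_mk_monic.
by rewrite eval1_in_qpoly // hornerM hornerD hornerX hornerN hornerC subrr mul0r.
Qed.

Definition dune_gen (v : 'I_n) : augZ := Sub ((cx - 1) * fv v) (dune_gen_aug v).

Definition sand_dune_group : zmodType :=
  zquot [seq dune_gen v | v <- enum 'I_n & val v != 0%N].

End DeBruijn.

Section Circulant.
Variables n d : nat.

(* The library's general linear group {'GL_n(d)} consists of matrices of size
   n.-1.+1, which is n for n > 0. *)
Local Notation N := n.-1.+1.

Definition cycle_mx : 'M['F_d]_N := perm_mx (perm (@ordS_inj N)).

Definition Qn : {'GL_n(d)} := FinRing.Unit (unitmx_perm _ (perm (@ordS_inj N))).

Definition is_circulant (A : 'M['F_d]_N) : bool :=
  [exists a : {ffun 'I_N -> 'F_d}, A == \sum_i a i *: cycle_mx ^+ i.+1].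

Definition circulant_group : {set {'GL_n(d)}} := [set g | is_circulant (GLval g)].

Definition circulant_group1 : {set {'GL_n(d)}} :=
  [set g in circulant_group |
    GLval g *m const_mx 1 == const_mx 1 :> 'cV['F_d]_N].

Fact cycle_mx_expN : cycle_mx ^+ N = 1.
Proof.
have E k : cycle_mx ^+ k = perm_mx ((perm (@ordS_inj N)) ^+ k).
  elim: k => [|k IH]; first by rewrite perm_mx1.
  by rewrite exprS IH expgS perm_mxM.
rewrite E -[RHS](perm_mx1 'F_d N); congr perm_mx; apply/permP => i; rewrite permX perm1.
have H k : iter k (perm (@ordS_inj N)) i = ((i + k) %% N)%N :> nat.
  elim: k => [|k IH] /=; first by rewrite addn0 modn_small.
  by rewrite permE /= IH -addn1 modnDml addn1 addnS.
by apply: ord_inj; rewrite H modnDr modn_small.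
Qed.

Fact circulant_exp k : is_circulant (cycle_mx ^+ k).
Proof.
have [j ->] : exists j : 'I_N, cycle_mx ^+ k = cycle_mx ^+ j.+1.
  have E l : cycle_mx ^+ (l %% N)%N = cycle_mx ^+ l.
    by rewrite [in RHS](divn_eq l N) exprD mulnC exprM cycle_mx_expN expr1n mul1r.
  exists (inord ((k + n.-1) %% N)%N).
  rewrite inordK ?ltn_pmod // exprS E -exprS -addnS -[LHS]E.
  by rewrite -modnDr E.
apply/existsP; exists [ffun i => (i == j)%:R]; rewrite (bigD1 j) //= ffunE eqxx.
by rewrite scale1r big1 ?addr0 // => i /negbTE ij; rewrite ffunE ij scale0r.
Qed.

Fact circulantZD c A B :
  is_circulant A -> is_circulant B -> is_circulant (c *: A + B).
Proof.
move=> /existsP[a /eqP->] /existsP[b /eqP->]; apply/existsP.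
exists [ffun i => c * a i + b i]; rewrite scaler_sumr -big_split /=.
by apply/eqP/eq_bigr => i _; rewrite ffunE scalerDl scalerA.
Qed.

Fact circulant_sum (a : 'I_N -> 'F_d) (A : 'I_N -> 'M['F_d]_N) :
  (forall i, is_circulant (A i)) -> is_circulant (\sum_i a i *: A i).
Proof.
move=> cA; apply: (big_rec (fun A => is_circulant A)) => [|i B _ cB].
  2: exact: circulantZD (cA i) cB.
apply/existsP; exists [ffun => 0]; rewrite big1 // => i _.
by rewrite ffunE scale0r.
Qed.

Fact circulantM A B : is_circulant A -> is_circulant B -> is_circulant (A *m B).
Proof.
move=> /existsP[a /eqP->] /existsP[b /eqP->]; rewrite mulmx_suml.
have -> : forall F : 'I_N -> 'M['F_d]_N, \sum_i F i = \sum_i 1 *: F i.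
  by move=> F; apply: eq_bigr => i _; rewrite scale1r.
apply: circulant_sum => i; rewrite -scalemxAl mulmx_sumr scaler_sumr.
under eq_bigr => j _ do rewrite -scalemxAr scalerA.
apply: circulant_sum => j; rewrite mulmxE -exprD; exact: circulant_exp.
Qed.

Fact circulant_group_set : group_set circulant_group.
Proof.
apply/group_setP; split=> [|g h]; rewrite !inE; first exact: (circulant_exp 0).
exact: circulantM.
Qed.

Canonical circulant_group_group := Group circulant_group_set.

Fact circulant_group1_set : group_set circulant_group1.
Proof.
apply/group_setP; split=> [|g h]; rewrite inE; first by rewrite group1 mul1mx /=.
move=> /andP[cg /eqP g1]; rewrite inE => /andP[ch /eqP h1].
by rewrite inE groupM //= -mulmxA h1 g1.
Qed.

Canonical circulant_group1_group := Group circulant_group1_set.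

Fact Qn_circulant_group1 : Qn \in circulant_group1.
Proof.
rewrite !inE; apply/andP; split; first exact: (circulant_exp 1).
by apply/eqP/matrixP => i j; rewrite /= -row_permE !mxE.
Qed.

End Circulant.

(* Main.v *)
Require Import Defs.
From mathcomp Require Import all_boot all_order all_fingroup all_algebra.
From mathcomp Require Import all_solvable all_field ring.
From mathcomp Require Import generic_quotient ring_quotient qpoly boolp.

Set Implicit Arguments.
Unset Strict Implicit.
Unset Printing Implicit Defensive.

Import GRing.Theory FinRing.Theory Num.Theory.
Import Quotient.Exports.

(** Let A be the dual of the sand dune group: the functions f from Z_n to Q/Z
    such that f 0 = 0 and d f(v) = f(d v), the number f(v) being the value at
    e_v = x^v - 1. The core of the proof is an isomorphism from A to C'(n,d)
    that sends the function chi : v |-> v/n to Q_n. (In the statements below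
    on Z_n and on circulants, the sizes n and m of these explanations are
    written n.+1 and m.+1.)

    - If d does not divide n, a circulant p(Q_n) is determined by its
      eigenvalues p(zeta^v), where zeta is a primitive n-th root of unity in a
      field K with d^b elements. With p(1) = 1, the families that occur are the
      functions u from Z_n to the units of K with u(0) = 1 and
      u(v)^d = u(d v); through an embedding of these units into Q/Z they are
      the elements of A ([dual_matching_coprime]).
    - If n = d m, multiplication by d in A turns f into v |-> f(d v), which
      depends on v modulo m only; and p(Q_n)^d = p^d(Q_n) depends on p modulo
      X^m - 1 only, because X^n - 1 = (X^m - 1)^d. So on both sides the d-th
      powers form a copy of the group attached to m. Both groups have d^(n-m)
      elements killed by d, and neither chi nor Q_n is a d-th power. These facts
      suffice to lift an isomorphism from m to n ([lift_iso_of_powers],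
      [dual_matching_step]).

    Next, A is a cokernel. Let B be the operator f(v) |-> d f(v) - f(d v) on
    integer functions vanishing at 0. It is injective, and an element of A,
    lifted to a rational function f, is determined by the integer function B f
    modulo the image of B ([dune_hom]). So C'(n,d) is the cokernel of B on
    columns, whereas Sigma(n,d) is its cokernel on rows. By the Smith normal
    form a square integer matrix is equivalent to its transpose
    ([tr_equivalent]), whence Sigma(n,d) = C'(n,d).

    In the same way S(n,d) is the torsion of the cokernel of the Laplacian on
    columns, and this torsion consists of the classes of the vectors of sum 0.
    Partial sums turn these vectors into functions vanishing at 0, and turn the
    image of the Laplacian into the image of B together with the multiples of
    v |-> floor(d v / n), which is B applied to v/n and so corresponds to chi
    ([antidiff_laplacian]). Hence S(n,d) = C'(n,d) / <Q_n>. *)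

(** * Extending isomorphisms between finite abelian groups *)

Section GraphLift.
Local Open Scope group_scope.

Variables (gT hT : finGroupType) (p : nat).
Hypothesis p_pr : prime p.

Lemma mem_of_coprime_powers (rT : finGroupType) (K : {group rT}) z i :
  ~~ (p %| i) -> z ^+ p \in K -> z ^+ i \in K -> z \in K.
Proof.
move=> pi zp zi; have i0 : 0 < i by case: i pi {zi} => //; rewrite dvdn0.
case: (egcdnP p i0) => u v E _; have /eqP g1 : gcdn i p == 1%N.
  by rewrite gcdnC -/(coprime p i) prime_coprime.
have : z ^+ (u * i) \in K by rewrite mulnC expgM groupX.
by rewrite E g1 expgD expg1 groupMl // mulnC expgM groupX.
Qed.

Variables (G : {group gT}) (H : {group hT}).
Hypotheses (abG : abelian G) (abH : abelian H).

(** Homomorphisms are given by their graphs, so that extending one means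
    enlarging a subgroup of the product. A subgroup of G x H satisfying the
    second condition is the graph of an isomorphism between its projections. *)
Definition partial_iso (D : {set gT * hT}) : bool :=
  (D \subset setX G H) && [forall z in D, (z.1 == 1) == (z.2 == 1)].

Definition total_iso (D : {set gT * hT}) : bool :=
  [&& partial_iso D, G \subset fst @: D & H \subset snd @: D].

Implicit Type D : {group gT * hT}.

Lemma partial_iso_sub D z : partial_iso D -> z \in D -> z.1 \in G /\ z.2 \in H.
Proof.
by case/andP=> /subsetP s _ /s; rewrite inE => /andP[].
Qed.

Lemma partial_iso1 D z : partial_iso D -> z \in D -> (z.1 == 1) = (z.2 == 1).
Proof. by case/andP=> _ /forall_inP e /e /eqP. Qed.

Lemma partial_iso_inj1 D x y y' :
  partial_iso D -> (x, y) \in D -> (x, y') \in D -> y = y'.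
Proof.
move=> pD a b; apply/eqP; rewrite eq_mulgV1.
by rewrite -(partial_iso1 pD (groupM a (groupVr b))) /= mulgV.
Qed.

Lemma partial_iso_inj2 D x x' y :
  partial_iso D -> (x, y) \in D -> (x', y) \in D -> x = x'.
Proof.
move=> pD a b; apply/eqP; rewrite eq_mulgV1.
by rewrite (partial_iso1 pD (groupM a (groupVr b))) /= mulgV.
Qed.

Lemma expg_pair (x : gT) (y : hT) i : (x, y) ^+ i = (x ^+ i, y ^+ i).
Proof. by elim: i => // i IH; rewrite !expgS IH. Qed.

(** Powers of (z, h) with exponent divisible by p lie in D already. For any
    other exponent, a trivial coordinate would put that power of z, or of h,
    into the projection of D, hence by coprimality z or h itself. *)
Lemma partial_iso_extend D z h :
    partial_iso D -> z \in G -> h \in H -> (z ^+ p, h ^+ p) \in D ->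
    z \notin fst @: D -> h \notin snd @: D ->
  partial_iso (D <*> <[(z, h)]>).
Proof.
move=> pD zG hH zhD nz nh; have [sD _] := andP pD.
have sC : <[(z, h)]> \subset setX G H by rewrite cycle_subG inE /= zG.
have abX : abelian (setX G H).
  apply/centsP=> -[a b] /setXP[/= aG bH] [a' b'] /setXP[/= aG' bH'].
  by congr pair; [apply: (centsP abG) | apply: (centsP abH)].
rewrite /partial_iso join_subG sD sC /= cent_joinEr; last first.
  exact: subset_trans sC (subset_trans abX (centS sD)).
apply/forall_inP => _ /mulsgP[g _ gD /cycleP[i ->] ->].
have [/dvdnP[j ->]|pi] := boolP (p %| i).
  rewrite (partial_iso1 pD) // groupM // mulnC expgM expg_pair groupX //.
have E1 (x : gT) : x \in fst @: D = (x \in fst @* D) by rewrite morphimE setTI.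
have E2 (x : hT) : x \in snd @: D = (x \in snd @* D) by rewrite morphimE setTI.
have z1 : z ^+ i \notin fst @* D.
  apply: contra nz; rewrite E1; apply: mem_of_coprime_powers pi _.
  by rewrite -E1; apply/imsetP; exists (z ^+ p, h ^+ p).
have h1 : h ^+ i \notin snd @* D.
  apply: contra nh; rewrite E2; apply: mem_of_coprime_powers pi _.
  by rewrite -E2; apply/imsetP; exists (z ^+ p, h ^+ p).
rewrite expg_pair /=; apply/eqP; apply/idP/idP => /eqP e.
  case/negP: z1; rewrite -E1; apply/imsetP; exists (g^-1); rewrite ?groupV //=.
  by rewrite -(mulKg g.1 (z ^+ i)) e mulg1.
case/negP: h1; rewrite -E2; apply/imsetP; exists (g^-1); rewrite ?groupV //=.
by rewrite -(mulKg g.2 (h ^+ i)) e mulg1.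
Qed.

Definition ptorsion (rT : finGroupType) (K : {set rT}) : {set rT} :=
  [set x in K | x ^+ p == 1].

(** D matches the p-torsion of its two projections, so that equality of the
    numbers of p-torsion elements transfers fullness from one side to the
    other. *)
Lemma ptorsion_graph D :
    partial_iso D -> #|ptorsion G| = #|ptorsion H| ->
  (ptorsion G \subset fst @: D) = (ptorsion H \subset snd @: D).
Proof.
move=> pD eGH; pose Dp := [set z in D | z.1 ^+ p == 1].
have Dp2 z : z \in D -> (z.1 ^+ p == 1) = (z.2 ^+ p == 1).
  case: z => a b ab; have := partial_iso1 pD (groupX p ab).
  by rewrite expg_pair.
have key (rT : finType) (f : gT * hT -> rT) (S : {set rT}) :
    {in Dp &, injective f} -> f @: Dp \subset S ->
    (forall z, z \in D -> f z \in S -> z \in Dp) ->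
  (S \subset f @: D) = (#|Dp| == #|S|).
  move=> fI fS Sf; rewrite -(card_in_imset fI); apply/idP/eqP => [/subsetP sS|c].
    suff -> : f @: Dp = S by [].
    apply/eqP; rewrite eqEsubset fS; apply/subsetP=> a aS.
    have /imsetP[z zD az] := sS a aS; apply/imsetP; exists z => //.
    by apply: Sf; rewrite -?az.
  have /eqP <- : f @: Dp == S by rewrite eqEcard fS c leqnn.
  by apply/imsetS/subsetP=> z; rewrite inE => /andP[].
rewrite (key _ fst) ?(key _ snd) ?eGH //.
- move=> [a b] [a' b']; rewrite !inE => /andP[ab _] /andP[ab' _] /= bb'.
  by move: bb' ab' => <- ab'; rewrite (partial_iso_inj2 pD ab ab').
- apply/subsetP=> _ /imsetP[z /[1!inE] /andP[zD zp] ->]; rewrite inE.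
  by rewrite -(Dp2 _ zD) zp andbT; case: (partial_iso_sub pD zD).
- by move=> z zD; rewrite !inE zD Dp2 // => /andP[].
- move=> [a b] [a' b']; rewrite !inE => /andP[ab _] /andP[ab' _] /= aa'.
  by move: aa' ab' => <- ab'; rewrite (partial_iso_inj1 pD ab ab').
- apply/subsetP=> _ /imsetP[z /[1!inE] /andP[zD zp] ->]; rewrite inE.
  by rewrite zp andbT; case: (partial_iso_sub pD zD).
- by move=> z zD; rewrite !inE zD => /andP[].
Qed.

(** Take D maximal among the partial isomorphisms containing D0 and (x, y).
    If z were missed, every h such that (z^p, h^p) is in D0 would be hit. These
    h form a coset of the p-torsion of H; so all p-torsion is hit, in H and then
    in G by counting, and z, which differs from a hit element by p-torsion, is
    hit after all. *)
Lemma lift_iso_of_powers D0 x y :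
    partial_iso D0 ->
    (forall g, g \in G -> exists2 h, h \in H & (g ^+ p, h ^+ p) \in D0) ->
    (forall h, h \in H -> exists2 g, g \in G & (g ^+ p, h ^+ p) \in D0) ->
    #|ptorsion G| = #|ptorsion H| ->
    x \in G -> y \in H -> (x ^+ p, y ^+ p) \in D0 ->
    x \notin fst @: D0 -> y \notin snd @: D0 ->
  exists D, total_iso D /\ (x, y) \in D.
Proof.
move=> p0 D0G D0H eT xG yH xy nx ny.
pose D1 := (D0 <*> <[(x, y)]>)%G.
have p1 : partial_iso D1 by apply: partial_iso_extend.
have D01 : D0 \subset D1 by apply: joing_subl.
have xyD1 : (x, y) \in D1 by rewrite -cycle_subG joing_subr.
have [D /maxgroupP[pD maxD] sD1] :=
  @maxgroup_exists _ (fun A : {group gT * hT} => partial_iso A) D1 p1.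
exists D; split; last by apply: (subsetP sD1).
have sD0 := subset_trans D01 sD1.
have quotD (A : {group gT}) z z' : z ^+ p = z' ^+ p -> z \in G -> z' \in G ->
    ptorsion G \subset A -> z' \in A -> z \in A.
  move=> e zG z'G /subsetP sA z'A; rewrite -(groupMr z (groupVr z'A)).
  apply: sA; rewrite inE groupM ?groupV //= expgMn; last first.
    by apply: (centsP abG); rewrite ?groupV.
  by rewrite expgVn e mulgV.
have quotH (A : {group hT}) z z' : z ^+ p = z' ^+ p -> z \in H -> z' \in H ->
    ptorsion H \subset A -> z' \in A -> z \in A.
  move=> e zG z'G /subsetP sA z'A; rewrite -(groupMr z (groupVr z'A)).
  apply: sA; rewrite inE groupM ?groupV //= expgMn; last first.
    by apply: (centsP abH); rewrite ?groupV.
  by rewrite expgVn e mulgV.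
have E1 : fst @: D = fst @* D by rewrite morphimE setTI.
have E2 : snd @: D = snd @* D by rewrite morphimE setTI.
have sG : G \subset fst @: D.
  apply/subsetP=> z zG; apply: contraT => nz.
  have [h0 h0H /(subsetP sD0) zh0] := D0G z zG.
  (* By maximality: otherwise (z, h) could be added to D. *)
  have all_in h : h \in H -> h ^+ p = h0 ^+ p -> h \in snd @: D.
    move=> hH e; apply: contraT => nh; rewrite -e in zh0.
    have pE := partial_iso_extend pD zG hH zh0 nz nh.
    have sE : D \subset D <*> <[(z, h)]> by apply: joing_subl.
    have eD := maxD (D <*> <[(z, h)]>)%G pE sE.
    case/imsetP: nh; exists (z, h) => //; rewrite -eD.
    by rewrite -cycle_subG joing_subr.
  have sT : ptorsion H \subset snd @: D.
    apply/subsetP=> t; rewrite inE => /andP[tH /eqP tp].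
    have h0D := all_in h0 h0H erefl; have : h0 * t \in snd @: D.
      apply: all_in; first exact: groupM.
      by rewrite expgMn ?tp ?mulg1 //; apply: (centsP abH).
    by move: h0D; rewrite E2 => h0D; rewrite groupMl.
  case/imsetP: (all_in h0 h0H erefl) => -[z' h'] zD /= e.
  rewrite -{}e in zD; have [/= z'G _] := partial_iso_sub pD zD.
  have e : z ^+ p = z' ^+ p.
    by apply: (partial_iso_inj2 pD zh0); rewrite -expg_pair groupX.
  move: nz; rewrite E1 => /negP[]; apply: (quotD _ z z' e) => //=; rewrite -E1.
    by rewrite ptorsion_graph.
  by apply/imsetP; exists (z', h0).
rewrite /total_iso pD sG; apply/subsetP=> h hH.
have [z zG /(subsetP sD0) zh] := D0H h hH.
have /imsetP[[z' h'] zD /= e] := subsetP sG z zG.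
rewrite -{}e in zD; have [/= _ h'H] := partial_iso_sub pD zD.
have e : h ^+ p = h' ^+ p.
  by apply: (partial_iso_inj1 pD zh); rewrite -expg_pair groupX.
rewrite E2; apply: (quotH _ h h' e) => //=; rewrite -E2; last first.
  by apply/imsetP; exists (z, h').
rewrite -ptorsion_graph //; apply: subset_trans sG.
by apply/subsetP=> t; rewrite inE => /andP[].
Qed.

End GraphLift.

Local Open Scope ring_scope.

(** * Homomorphisms from quotients to finite groups *)

Section QuotientIso.
Local Open Scope quotient_scope.

Variables (V : zmodType) (s : seq V) (gT : finGroupType) (k : V -> gT).
Hypothesis kD : forall x y, k (x + y) = (k x * k y)%g.

Lemma additive_hom0 : k 0 = 1%g.
Proof. by apply: (@mulgI _ (k 0)); rewrite mulg1 -kD addr0. Qed.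

Lemma additive_homN x : k (- x) = (k x)^-1%g.
Proof. by apply: (@mulgI _ (k x)); rewrite mulgV -kD subrr additive_hom0. Qed.

Lemma additive_homB x y : (k x = k y) <-> (k (x - y) = 1%g).
Proof.
rewrite kD additive_homN; split=> [->|]; first by rewrite mulgV.
by move/eqP; rewrite -eq_mulgV1 => /eqP.
Qed.

Lemma additive_homMn x m : k (x *+ m) = (k x ^+ m)%g.
Proof.
by elim: m => [|m IH]; rewrite ?mulr0n ?additive_hom0 // mulrS expgS kD IH.
Qed.

Local Notation zpi := (\pi_(zquot s)).

Lemma zpi0 : zpi 0 = 0. Proof. by rewrite piE. Qed.

Lemma zpiD x y : zpi (x + y) = zpi x + zpi y.
Proof. exact: Quotient.pi_add. Qed.

Lemma zpiN x : zpi (- x) = - zpi x.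
Proof. exact: Quotient.pi_opp. Qed.

Lemma zpiMn x m : zpi (x *+ m) = zpi x *+ m.
Proof. by elim: m => [|m IH]; rewrite ?mulr0n ?zpi0 // !mulrS zpiD IH. Qed.

Lemma zpi_eq0 x : (zpi x == 0) = (x \in int_span s).
Proof. by rewrite -zpi0 -Quotient.idealrBE subr0. Qed.

Lemma repr_zquot x : repr (\pi_(zquot s) x) - x \in int_span s.
Proof. by rewrite Quotient.idealrBE reprK. Qed.

Lemma repr_zquotD (x y : zquot s) :
  repr (x + y) - (repr x + repr y) \in int_span s.
Proof. by rewrite Quotient.idealrBE reprK zpiD !reprK. Qed.

Lemma zquot_isog (G : {set gT}) :
    (forall x, k x = 1%g <-> x \in int_span s) ->
    (forall g, g \in G <-> exists x, k x = g) ->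
  zmod_isog (zquot s) G.
Proof.
move=> kI kG; exists (fun q => k (repr q)); split=> [q r /additive_homB/kI|q r|g].
- by rewrite Quotient.idealrBE !reprK => /eqP.
- by rewrite -kD; apply/additive_homB/kI/repr_zquotD.
rewrite kG; split=> [[x <-]|[q <-]]; last by exists (repr q).
by exists (\pi x); apply/additive_homB/kI/repr_zquot.
Qed.

Definition torsion_mod : pred V :=
  fun x => `[< exists2 m, (0 < m)%N & x *+ m \in int_span s >].

Lemma tors_zquot x : (zpi x \in @tors (zquot s)) = torsion_mod x.
Proof.
apply/asboolP/asboolP=> -[m m0]; first by rewrite -zpiMn => /eqP; rewrite zpi_eq0; exists m.
by rewrite -zpi_eq0 zpiMn => /eqP; exists m.
Qed.

(** The kernel of k is constrained on torsion classes only, because the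
    cokernel of a Laplacian is infinite. *)
Lemma torsion_zquot_isog (G : {set gT}) :
    (forall x, x \in int_span s -> k x = 1%g) ->
    (forall x, torsion_mod x -> k x = 1%g -> x \in int_span s) ->
    (forall g, g \in G <-> exists2 x, torsion_mod x & k x = g) ->
  zmod_isog (torsion_subgroup (zquot s)) G.
Proof.
move=> k1 kI kG.
have tV (q : torsion_subgroup (zquot s)) : torsion_mod (repr (val q)).
  by rewrite -tors_zquot reprK (valP q).
exists (fun q => k (repr (val q))); split=> [q r|q r|g].
- move/additive_homB/kI => I; apply/val_inj.
  rewrite -[val q]reprK -[val r]reprK; apply/eqP.
  rewrite -Quotient.idealrBE; apply: I; rewrite -tors_zquot zpiD zpiN !reprK.
  by rewrite rpredB ?(valP q, valP r).
- by rewrite -kD; apply/additive_homB/k1/repr_zquotD.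
rewrite kG; split=> [[x tx <-]|[q <-]]; last by exists (repr (val q)).
have tx' : \pi_(zquot s) x \in @tors (zquot s) by rewrite tors_zquot.
exists (exist (fun q => q \in @tors (zquot s)) _ tx' : torsion_subgroup (zquot s)).
by apply/additive_homB/k1/repr_zquot.
Qed.

End QuotientIso.

Section Span.
Variables (V : zmodType) (s : seq V).

Lemma mem_int_span x : x \in s -> x \in int_span s.
Proof.
move=> xs; apply/asboolP; have xi : (index x s < size s)%N by rewrite index_mem.
exists [ffun i => (i == Ordinal xi)%:R]; rewrite (bigD1 (Ordinal xi)) //= big1 ?addr0.
  by rewrite ffunE eqxx mulr1z nth_index.
by move=> i /negbTE ni; rewrite ffunE ni mulr0z.
Qed.

Lemma hom_int_span (gT : finGroupType) (k : V -> gT) :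
    (forall x y, k (x + y) = (k x * k y)%g) ->
  (forall x, x \in s -> k x = 1%g) -> forall x, x \in int_span s -> k x = 1%g.
Proof.
move=> kD k1 x /asboolP[a ->].
apply: (big_ind (fun x => k x = 1%g)) => [|y z ky kz|i _].
- exact: additive_hom0.
- by rewrite kD ky kz mulg1.
have kn m : k (s`_i *+ m) = 1%g.
  by rewrite (additive_homMn kD) k1 ?expg1n // mem_nth.
by case: (a i) => m; rewrite ?NegzE ?mulrNz -pmulrn ?(additive_homN kD) kn ?invg1.
Qed.

End Span.

(** * An integer matrix and its transpose *)

(** Both B and its transpose are equivalent to the Smith normal form of B.
    It follows that U induces an isomorphism from the cokernel of B on rows to
    its cokernel on columns. *)
Lemma tr_equivalent n (B : 'M[int]_n) :
  exists U V : 'M[int]_n, [/\ U \in unitmx, V \in unitmx & U *m B^T = B *m V].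
Proof.
have [L uL [R uR [s _ ->]]] := int_Smith_normal_form B.
set D := \matrix_(i, j) _.
have DT : D^T = D.
  apply/matrixP=> i j; rewrite !mxE eq_sym.
  by case: eqP => [->|]; rewrite ?mulr0n.
exists (L *m invmx R^T), (invmx R *m L^T).
split; rewrite ?unitmx_mul ?unitmx_inv ?unitmx_tr ?uL ?uR //.
by rewrite !trmx_mul DT !mulmxA mulmxKV ?unitmx_tr // mulmxK.
Qed.

(** * Circulant matrices as polynomials modulo X^n - 1 *)

Section CirculantPoly.
Variables n d : nat.
Local Notation F := 'F_d.
Local Notation Q := (cycle_mx n.+1 d).
Local Notation Xn1 := ('X^(n.+1) - 1 : {poly F})%R.
Implicit Types (p q : {poly F}) (g : {'GL_n.+1(d)}).

Definition circ p : 'M[F]_n.+1 := horner_mx Q p.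

Lemma circD p q : circ (p + q) = circ p + circ q.
Proof. exact: rmorphD. Qed.
Lemma circB p q : circ (p - q) = circ p - circ q.
Proof. exact: rmorphB. Qed.
Lemma circM p q : circ (p * q) = circ p *m circ q.
Proof. exact: rmorphM. Qed.
Lemma circX : circ 'X = Q. Proof. exact: horner_mx_X. Qed.
Lemma circXn p k : circ (p ^+ k) = circ p ^+ k.
Proof. exact: rmorphXn. Qed.
Lemma circ1 : circ 1 = 1%:M. Proof. exact: rmorph1. Qed.

Lemma circ_row0 p : (size p <= n.+1)%N -> forall j : 'I_n.+1, circ p ord0 j = p`_j.
Proof.
move=> sp j.
have E k : (k < n.+1)%N -> (Q ^+ k) ord0 j = (j == k :> nat)%:R.
  move=> kn; have -> : Q ^+ k = perm_mx ((perm (@ordS_inj n.+1)) ^+ k).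
    elim: k {kn} => [|k IH]; first by rewrite perm_mx1.
    by rewrite exprS IH expgS perm_mxM.
  rewrite !mxE permX eq_sym; congr ((_ == _ :> nat)%:R).
  elim: k kn => //= k IH kn; rewrite permE /= IH ?modn_small //; exact: ltnW.
have -> : circ p = \sum_(i < n.+1) p`_i *: Q ^+ i.
  have {1}-> : p = \poly_(i < n.+1) p`_i.
    apply/polyP=> i; rewrite coef_poly; case: ltnP => // ni.
    by rewrite nth_default // (leq_trans sp).
  rewrite poly_def /circ linear_sum; apply: eq_bigr => i _.
  by rewrite linearZ /= rmorphXn /= horner_mx_X.
rewrite summxE.
rewrite (bigD1 j) //= big1 ?addr0 => [|i ij].
  by rewrite mxE E // eqxx mulr1.
by rewrite mxE E // eq_sym (inj_eq val_inj) (negbTE ij) mulr0.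
Qed.

Lemma size_Xn1 : size Xn1 = n.+2. Proof. by rewrite size_XnsubC. Qed.

Lemma Xn1_neq0 : Xn1 != 0. Proof. by rewrite -size_poly_gt0 size_Xn1. Qed.

Lemma circ_Xn1 : circ Xn1 = 0.
Proof. by rewrite circB circXn circX circ1 (cycle_mx_expN n.+1 d) subrr. Qed.

(** Modulo X^n - 1 the degree of p may be taken smaller than n, and then the
    coefficients of p form the first row of the matrix. *)
Lemma circ_eq0 p : (circ p == 0) = (Xn1 %| p).
Proof.
apply/eqP/idP => [c0|/dvdpP[q ->]]; last by rewrite circM circ_Xn1 mulmx0.
rewrite /dvdp -size_poly_eq0 size_poly_eq0; apply/eqP.
have cm0 : circ (p %% Xn1) = 0.
  by have := c0; rewrite [p in circ p](divp_eq p Xn1) circD circM circ_Xn1 mulmx0 add0r.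
have sm : (size (p %% Xn1)%R <= n.+1)%N.
  by have := ltn_modp p Xn1; rewrite Xn1_neq0 size_Xn1 ltnS.
apply/polyP=> i; rewrite coef0; case: (ltnP i n.+1) => ni.
  by rewrite -(circ_row0 sm (Ordinal ni)) cm0 mxE.
by rewrite nth_default // (leq_trans sm).
Qed.

Lemma circ_eq p q : (circ p == circ q) = (Xn1 %| p - q).
Proof. by rewrite -circ_eq0 circB subr_eq0. Qed.

Lemma is_circulantP (A : 'M[F]_n.+1) : @is_circulant n.+1 d A <-> exists p, A = circ p.
Proof.
split=> [/existsP[a /eqP->]|[p ->]].
  exists (\sum_i a i *: 'X^(i.+1)); rewrite /circ linear_sum /=.
  by apply: eq_bigr => i _; rewrite linearZ /= rmorphXn /= horner_mx_X.
elim/poly_ind: p => [|p c IH].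
  have := circulantZD (-1) (circulant_exp n.+1 d 0) (circulant_exp n.+1 d 0).
  by rewrite scaleN1r addNr /circ rmorph0.
have -> : circ (p * 'X + c%:P) = c *: (Q ^+ 0) + circ p *m Q.
  by rewrite circD circM circX addrC /circ horner_mx_C expr0 scalemx1.
apply: circulantZD; first exact: circulant_exp.
by apply: circulantM => //; have := circulant_exp n.+1 d 1.
Qed.

Lemma circ_const1 p : circ p *m const_mx 1 = const_mx p.[1] :> 'cV_n.+1.
Proof.
elim/poly_ind: p => [|p c IH]; first by rewrite /circ rmorph0 mul0mx horner0.
rewrite circD circM circX mulmxDl -mulmxA.
have -> : Q *m const_mx 1 = const_mx 1 :> 'cV_n.+1.
  by apply/matrixP => i j; rewrite -row_permE !mxE.
rewrite IH /circ horner_mx_C mul_scalar_mx hornerMXaddC mulr1.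
by apply/matrixP=> i j; rewrite !mxE mulr1.
Qed.

(** If q divides both p and X^n - 1 = r q, then p(Q) r(Q) = 0; so r(Q) = 0 when
    p(Q) is invertible, and q is constant. The converse is a Bezout relation. *)
Lemma circ_unit p : (circ p \in unitmx) = coprimep p Xn1.
Proof.
apply/idP/idP => [up|cop].
  apply/coprimepP => q qp qX.
  have /dvdpP[r Er] := qX; have /dvdpP[s Es] := qp.
  have : circ p *m circ r == 0.
    by rewrite -circM circ_eq0 Es Er -mulrA [q * r]mulrC dvdp_mull.
  move/eqP/(congr1 (mulmx (invmx (circ p)))); rewrite mulKmx // mulmx0 => /eqP.
  rewrite circ_eq0 => /dvdp_leq.
  move: (Xn1_neq0); rewrite Er mulf_eq0 negb_or => /andP[r0 q0] /(_ r0).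
  rewrite -size_poly_eq1 size_mul // => le_rq.
  have := size_poly_gt0 q; rewrite q0 leq_eqVlt eq_sym => /orP[//|q2].
  move: le_rq; rewrite leqNgt -subn1 ltn_subRL addnC ltn_add2l.
  by rewrite q2.
have [[u v] /= E] := Bezout_eq1_coprimepP _ _ cop.
suff : circ p *m circ u = 1%:M by move/mulmx1_unit => [].
rewrite mulmxE -rmorphM mulrC -circ1; apply/eqP; rewrite circ_eq.
suff -> : u * p - 1 = - v * Xn1 by rewrite dvdp_mull.
by apply/eqP; rewrite mulNr subr_eq addrC eq_sym subr_eq E.
Qed.

Lemma circulant_group1P g :
  reflect (exists2 p, p.[1] = 1 & GLval g = circ p) (g \in circulant_group1 n.+1 d).
Proof.
rewrite !inE; apply: (iffP andP) => [[/is_circulantP[p Ep] /eqP]|[p p1 Ep]].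
  rewrite Ep circ_const1 => /matrixP/(_ ord0 ord0); rewrite !mxE => p1.
  by exists p.
split; first by apply/is_circulantP; exists p.
by rewrite Ep circ_const1 p1.
Qed.

Lemma circulant_lift p : p.[1] = 1 -> coprimep p Xn1 ->
  exists2 g, g \in circulant_group1 n.+1 d & GLval g = circ p.
Proof.
rewrite -circ_unit => p1 up; exists (FinRing.Unit up) => //.
by apply/circulant_group1P; exists p.
Qed.

Lemma circulant_coprime g p : GLval g = circ p -> coprimep p Xn1.
Proof. by move=> E; rewrite -circ_unit -E; exact: (valP g). Qed.

Lemma GLval_inj : injective (@GLval n.+1 F).
Proof. exact: val_inj. Qed.

Lemma GLvalM (g h : {'GL_n.+1(d)}) : GLval (g * h)%g = GLval g *m GLval h.
Proof. by []. Qed.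

Lemma GLvalX (g : {'GL_n.+1(d)}) k : GLval (g ^+ k)%g = GLval g ^+ k.
Proof. exact: FinRing.val_unitX. Qed.

Lemma GLval_Qn : GLval (Qn n.+1 d) = circ 'X.
Proof. by rewrite circX. Qed.

End CirculantPoly.

(** * The dual of the sand dune group *)

Section ZModM.
Variable M : nat.
Hypothesis M1 : (1 < M)%N.

Lemma natZ_eq i j : (i%:R == j%:R :> 'Z_M) = (i == j %[mod M]).
Proof. by rewrite -val_eqE /= !val_Zp_nat. Qed.

Lemma natZ_eq0 i : (i%:R == 0 :> 'Z_M) = (M %| i)%N.
Proof. by rewrite -(mulr0n 1) natZ_eq mod0n. Qed.

Lemma natZ_val (x : 'Z_M) : x = (val x)%:R.
Proof. by rewrite natr_Zp. Qed.

Lemma ltn_Zval (x : 'Z_M) : (val x < M)%N.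
Proof. by have := ltn_ord x; rewrite [X in (_ < X)%N -> _]Zp_cast. Qed.

Lemma Z_killed e (x : 'Z_M) : (0 < e)%N -> (e %| M)%N -> x *+ e = 0 ->
  (M %/ e %| val x)%N.
Proof.
move=> e0 /dvdnP[f EM] /eqP xe; have -> : (M %/ e)%N = f by rewrite EM mulnK.
by move: xe; rewrite {1}(natZ_val x) -mulrnA natZ_eq0 [X in (X %| _)%N]EM dvdn_pmul2r.
Qed.

End ZModM.

Section Characters.
Variables M d : nat.
Hypothesis M1 : (1 < M)%N.

Section FixedSize.
Variable n : nat.
Implicit Type f : 'rV['Z_M]_n.+1.

(** A vector indexed by Z_n is read as a periodic function on [nat], which
    turns the multiplication of indices by d into an ordinary product. *)
Definition at_nat f (t : nat) : 'Z_M := f ord0 (inZp t).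

Lemma at_natE f (v : 'I_n.+1) : f ord0 v = at_nat f v.
Proof. by rewrite /at_nat valZpK. Qed.

Lemma at_nat_row (F : 'I_n.+1 -> 'Z_M) t : at_nat (\row_v F v) t = F (inZp t).
Proof. by rewrite /at_nat mxE. Qed.

Lemma eq_at_nat f t t' : t = t' %[mod n.+1] -> at_nat f t = at_nat f t'.
Proof. by move=> e; congr (f _ _); apply: val_inj. Qed.

(** The homomorphisms f from the sand dune group to Q/Z, given by their values
    f v at e_v = x^v - 1. Here Z/M stands for the subgroup (1/M)Z/Z of Q/Z,
    which contains all these values once n divides M = d^a (d^b - 1). *)
Definition dune_dual : {set 'rV['Z_M]_n.+1} :=
  [set f | (at_nat f 0 == 0) &&
     [forall v : 'I_n.+1, at_nat f v *+ d == at_nat f (d * v)]].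

Lemma dune_dualP f :
  reflect (at_nat f 0 = 0 /\ forall t, at_nat f t *+ d = at_nat f (d * t))
          (f \in dune_dual).
Proof.
rewrite inE; apply: (iffP andP) => -[/eqP f0 fd]; split=> //; last first.
  by apply/forallP=> v; rewrite fd.
move=> t; have /eqP := forallP fd (inZp t); rewrite -at_natE => ->.
by apply: eq_at_nat; rewrite /= modnMmr.
Qed.

Lemma dune_dual_group_set : group_set dune_dual.
Proof.
apply/group_setP; split=> [|f g /dune_dualP[f0 fd] /dune_dualP[g0 gd]].
  by apply/dune_dualP; split=> [|t]; rewrite /at_nat !mxE ?mul0rn.
apply/dune_dualP; rewrite zmodMgE /at_nat; split=> [|t].
  by rewrite mxE -!/(at_nat _ _) f0 g0 addr0.
by rewrite !mxE -!/(at_nat _ _) mulrnDl fd gd.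
Qed.

Canonical dune_dual_group := Group dune_dual_group_set.

Lemma dune_dualX f k t : f \in dune_dual ->
  at_nat f t *+ (d ^ k) = at_nat f (d ^ k * t).
Proof.
move=> /dune_dualP[_ fd]; elim: k => [|k IH]; first by rewrite mul1n.
by rewrite expnSr mulrnA IH fd mulnA [(d * _)%N]mulnC.
Qed.

(** The function v |-> v/n, whose kernel in the sand dune group is the image of
    the sandpile group under multiplication by x - 1. *)
Definition chi : 'rV['Z_M]_n.+1 := \row_v (v * (M %/ n.+1))%:R.

Hypothesis nM : (n.+1 %| M)%N.

Lemma at_chi t : at_nat chi t = (t * (M %/ n.+1))%:R.
Proof.
rewrite at_nat_row /=; apply/eqP; rewrite natZ_eq //; apply/eqP.
rewrite {2}(divn_eq t n.+1) mulnDl -mulnA [(n.+1 * _)%N]mulnC divnK //.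
by rewrite modnMDl.
Qed.

Lemma chi_dual : chi \in dune_dual.
Proof.
apply/dune_dualP; split=> [|t]; first by rewrite at_chi mul0n.
by rewrite !at_chi -mulrnA; congr (_ *+ _); rewrite mulnC mulnA.
Qed.

End FixedSize.

Section Inflation.
Variables n m : nat.
Hypothesis nm : n.+1 = (d * m.+1)%N.

(** The counterpart on circulants is the map from p(Q_m) to p(Q_n)^d. *)
Definition inflate (f : 'rV['Z_M]_m.+1) : 'rV['Z_M]_n.+1 := \row_v at_nat f v.

Lemma at_inflate f t : at_nat (inflate f) t = at_nat f t.
Proof. by rewrite at_nat_row; apply: eq_at_nat; rewrite /= nm modn_dvdm // dvdn_mull. Qed.

Lemma inflateD f g : inflate (f + g) = inflate f + inflate g.
Proof. by apply/rowP=> v; rewrite !mxE /at_nat mxE. Qed.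

Lemma inflate_dual f : f \in dune_dual m -> inflate f \in dune_dual n.
Proof.
move=> /dune_dualP[f0 fd]; apply/dune_dualP.
by split=> [|t]; rewrite !at_inflate ?f0 ?fd.
Qed.

Lemma eq_at f g : (forall t, at_nat f t = at_nat g t) -> f = g :> 'rV['Z_M]_n.+1.
Proof. by move=> e; apply/rowP=> v; rewrite !at_natE. Qed.

End Inflation.
End Characters.

(** * Lifting the duality from m to n = d m *)

Lemma abelian_circulant1 n d : abelian (circulant_group1 n.+1 d).
Proof.
apply/centsP=> g /circulant_group1P[p _ Eg] h /circulant_group1P[q _ Eh].
by apply: GLval_inj; rewrite !GLvalM Eg Eh -!circM mulrC.
Qed.

Section Period.
Variables d a b M : nat.
Hypotheses (d_pr : prime d) (b0 : (0 < b)%N).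
Hypothesis EM : M = (d ^ a * (d ^ b - 1))%N.
Hypothesis M1 : (1 < M)%N.

Lemma coprime_pred_exp : coprime d (d ^ b - 1).
Proof.
rewrite prime_coprime // -(dvdn_addl _ (dvdnn d)) //.
apply/negP=> dd; have : (d %| 1)%N.
  have db : (d %| d ^ b)%N by rewrite dvdn_exp.
  rewrite -(subKn (_ : 1 <= d ^ b)%N) ?expn_gt0 ?prime_gt0 // dvdn_sub //.
  by move: dd; rewrite dvdn_addl.
by rewrite dvdn1 => /eqP d1; move: d_pr; rewrite d1.
Qed.

(** d^k acts on f as the dilation of indices by d^k, and d^(k+b) = d^k
    modulo n. *)
Lemma dune_dual_killed n k (f : 'rV['Z_M]_n.+1) t :
  f \in dune_dual M d n -> (n.+1 %| d ^ k * (d ^ b - 1))%N ->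
  at_nat f t *+ (d ^ k * (d ^ b - 1)) = 0.
Proof.
move=> fA nk; rewrite mulnBr muln1 -expnD mulrnBr; last first.
  by rewrite leq_pexp2l ?leq_addr // prime_gt0.
rewrite !(dune_dualX _ _ fA); apply/eqP; rewrite subr_eq0; apply/eqP/eq_at_nat.
apply/eqP; rewrite eqn_mod_dvd; last first.
  by rewrite leq_mul2r leq_pexp2l ?leq_addr ?orbT // prime_gt0.
by rewrite -mulnBl expnD -[X in (_ - X)%N]muln1 -mulnBr dvdn_mulr.
Qed.

(** The duality between the sand dune group and C'(n,d). The condition on chi
    is what makes it descend to the sandpile group. *)
Definition dual_matching n : Prop :=
  exists D : {group 'rV['Z_M]_n.+1 * {'GL_n.+1(d)}},
    total_iso (dune_dual_group M d n) (circulant_group1_group n.+1 d) D /\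
    (chi M n, Qn n.+1 d) \in D.

Section Step.
Variables n m : nat.
Hypotheses (nm : n.+1 = (d * m.+1)%N) (nM : (n.+1 %| M)%N).

Local Notation F := 'F_d.
Local Notation Xn1 n := ('X^(n.+1) - 1 : {poly F}).

Lemma pcharF : d \in [pchar {poly F}].
Proof. by rewrite pchar_poly pchar_Fp. Qed.

Lemma exprB_char (p q : {poly F}) : (p - q) ^+ d = p ^+ d - q ^+ d.
Proof. by rewrite -!(pFrobenius_autE pcharF) pFrobenius_autB_comm //; apply: mulrC. Qed.

Lemma Xn1_exp : Xn1 n = Xn1 m ^+ d.
Proof. by rewrite exprB_char expr1n -exprM nm mulnC. Qed.

Lemma step_exponent : (0 < a)%N /\ (m.+1 %| d ^ a.-1 * (d ^ b - 1))%N.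
Proof.
move: nM; rewrite EM nm; case: a => [|a'] /=; last first.
  by rewrite expnS -mulnA dvdn_pmul2l // prime_gt0.
rewrite mul1n => nb; have : (d %| d ^ b - 1)%N := dvdn_trans (dvdn_mulr _ (dvdnn d)) nb.
move/gcdn_idPl; have /eqP -> := coprime_pred_exp.
by move=> d1; move: d_pr; rewrite -d1.
Qed.

Lemma M_step : (M = d * (d ^ a.-1 * (d ^ b - 1)))%N.
Proof. by have [a0 _] := step_exponent; rewrite mulnA -expnS prednK. Qed.

Lemma mM : (m.+1 %| M)%N.
Proof. by rewrite (dvdn_trans _ nM) // nm dvdn_mull. Qed.

Lemma d_gt0 : (0 < d)%N. Proof. exact: prime_gt0. Qed.

(** Both sides of the divisibility on the right are raised to the power d,
    which commutes with subtraction in characteristic d. *)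
Lemma Xn1_dvd_exp (p q : {poly F}) : (Xn1 n %| p ^+ d - q ^+ d) = (Xn1 m %| p - q).
Proof. by rewrite -exprB_char Xn1_exp dvdp_pexp2r // d_gt0. Qed.

Lemma circ_exp_eq (p q : {poly F}) :
  (circ n (p ^+ d) == circ n (q ^+ d)) = (circ m p == circ m q).
Proof. by rewrite !circ_eq Xn1_dvd_exp. Qed.

Lemma coprimep_Xn1 (p : {poly F}) : coprimep p (Xn1 n) = coprimep p (Xn1 m).
Proof. by rewrite Xn1_exp coprimep_pexpr // d_gt0. Qed.

Section Lifting.
Variable D : {group 'rV['Z_M]_m.+1 * {'GL_m.+1(d)}}.
Hypothesis totD : total_iso (dune_dual_group M d m) (circulant_group1_group m.+1 d) D.

(** What a duality D for m prescribes on d-th powers for n. *)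
Definition frob_graph : {set 'rV['Z_M]_n.+1 * {'GL_n.+1(d)}} :=
  [set z : 'rV['Z_M]_n.+1 * {'GL_n.+1(d)} | `[< exists f g p,
           [/\ (f, g) \in D, GLval g = circ m p, p.[1] = 1,
                z.1 = inflate n f & GLval z.2 = circ n (p ^+ d)] >]].

Lemma frob_graphP (z : 'rV['Z_M]_n.+1 * {'GL_n.+1(d)}) : reflect
  (exists f g p, [/\ (f, g) \in D, GLval g = circ m p, p.[1] = 1,
                z.1 = inflate n f & GLval z.2 = circ n (p ^+ d)])
  (z \in frob_graph).
Proof. by rewrite inE; apply: asboolP. Qed.

Lemma frob_graph_group_set : group_set frob_graph.
Proof.
apply/group_setP; split.
  apply/frob_graphP; exists 0, 1%g, 1; split; rewrite ?group1 ?circ1 ?hornerC //.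
    by apply/rowP=> v; rewrite !mxE /at_nat mxE.
  by rewrite expr1n circ1.
move=> z z' /frob_graphP[f [g [p [fg Eg p1 z1 z2]]]].
move=> /frob_graphP[f' [g' [p' [fg' Eg' p1' z1' z2']]]].
apply/frob_graphP; exists (f + f'), (g * g')%g, (p * p'); split.
- by have := groupM fg fg'.
- by rewrite GLvalM Eg Eg' circM.
- by rewrite hornerM p1 p1' mulr1.
- by rewrite inflateD -z1 -z1'.
by rewrite GLvalM z2 z2' exprMn circM.
Qed.

Canonical frob_graph_group := Group frob_graph_group_set.

Lemma inflate_inj (f g : 'rV['Z_M]_m.+1) : inflate n f = inflate n g -> f = g.
Proof.
by move=> e; apply: eq_at => t; rewrite -!(at_inflate nm) e.
Qed.

Lemma frob_graph_iso :
  partial_iso (dune_dual_group M d n) (circulant_group1_group n.+1 d) frob_graph.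
Proof.
have /and3P[pD _ _] := totD.
apply/andP; split; last first.
  apply/forall_inP=> -[f' g'] /frob_graphP[f [g [p [fg Eg p1 /= -> E]]]].
  have -> : (g' == 1%g) = (g == 1%g).
    have := circ_exp_eq p 1; rewrite expr1n !circ1 -E -Eg.
    by rewrite (inj_eq (@GLval_inj _ _) _ 1%g) (inj_eq (@GLval_inj _ _) _ 1%g).
  have := partial_iso1 pD fg => /= <-.
  have -> : (1%g : 'rV['Z_M]_n.+1) = inflate n (1%g : 'rV['Z_M]_m.+1).
    by apply/rowP=> v; rewrite !mxE /at_nat mxE.
  by rewrite (inj_eq inflate_inj).
apply/subsetP=> -[f' g'] /frob_graphP[f [g [p [fg Eg p1 /= -> E]]]].
have [/= fA gC] := partial_iso_sub pD fg.
rewrite inE /= inflate_dual //=; apply/circulant_group1P.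
by exists (p ^+ d); rewrite // horner_exp p1 expr1n.
Qed.

(** The multiple d f is the inflation of w |-> f(d w). *)
Lemma frob_graph_fst f : f \in dune_dual M d n ->
  exists2 h, h \in circulant_group1 n.+1 d & (f ^+ d, h ^+ d)%g \in frob_graph.
Proof.
move=> /dune_dualP[f0 fd]; have /and3P[pD /subsetP sD _] := totD.
pose f1 : 'rV['Z_M]_m.+1 := \row_w at_nat f (d * w).
have atf1 t : at_nat f1 t = at_nat f (d * t).
  by rewrite at_nat_row; apply: eq_at_nat; rewrite /= nm muln_modr modn_mod.
have f1A : f1 \in dune_dual M d m.
  by apply/dune_dualP; split=> [|t]; rewrite !atf1 ?muln0 // fd.
have /imsetP[[f1' g] fg /= e] := sD f1 f1A; rewrite -{}e in fg.
have [_ /circulant_group1P[p p1 Eg]] := partial_iso_sub pD fg.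
have cop := circulant_coprime Eg; rewrite -coprimep_Xn1 in cop.
have [h hC Eh] := circulant_lift p1 cop.
exists h => //; apply/frob_graphP; exists f1, g, p; split=> //=.
  by apply: eq_at => t; rewrite (at_inflate nm) atf1 -fd zmodXgE /at_nat mulmxnE.
by rewrite GLvalX Eh circXn.
Qed.

(** The equation d f = inflate f0 is solvable in Z/M because the values of f0
    are divisible by d: they are killed by M/d, which m divides. *)
Lemma frob_graph_snd h : h \in circulant_group1 n.+1 d ->
  exists2 f, f \in dune_dual M d n & (f ^+ d, h ^+ d)%g \in frob_graph.
Proof.
move=> /circulant_group1P[p p1 Eh]; have /and3P[pD _ /subsetP sD] := totD.
have cop := circulant_coprime Eh; rewrite coprimep_Xn1 in cop.
have [g gC Eg] := circulant_lift p1 cop.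
have /imsetP[[f0 g'] fg /= e] := sD g gC; rewrite -{}e in fg.
have [/= f0A _] := partial_iso_sub pD fg; have /dune_dualP[f00 f0d] := f0A.
have [a0 ma] := step_exponent.
have dval t : (d %| val (at_nat f0 t))%N.
  have K0 : (0 < d ^ a.-1 * (d ^ b - 1))%N.
    by move: (ltnW M1); rewrite M_step muln_gt0 => /andP[].
  have := Z_killed M1 K0 _ (dune_dual_killed t f0A ma).
  by rewrite {1 2}M_step mulnK // => -> //; rewrite dvdn_mull.
(* The equation d f = inflate f0 leaves d choices for each value, but
   f(d w) = d f(w) forces the value f0 w at d w. *)
pose F v := if (d %| v)%N then at_nat f0 (v %/ d)
            else ((val (at_nat f0 v)) %/ d)%:R.
have FM v : F v *+ d = at_nat f0 v.
  rewrite /F; case: ifP => dv; first by rewrite f0d mulnC divnK.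
  by rewrite -mulrnA divnK // -natZ_val.
pose f : 'rV['Z_M]_n.+1 := \row_v F v.
have atfM t : at_nat f t *+ d = at_nat f0 t.
  by rewrite at_nat_row FM; apply: eq_at_nat; rewrite /= nm modn_dvdm // dvdn_mull.
exists f.
  apply/dune_dualP; split=> [|t].
    by rewrite at_nat_row /= mod0n /F dvdn0 div0n.
  rewrite atfM at_nat_row /= nm -muln_modr /F dvdn_mulr // mulKn ?d_gt0 //.
  by apply: eq_at_nat; rewrite modn_mod.
apply/frob_graphP; exists f0, g, p; split=> //=.
  by apply: eq_at => t; rewrite (at_inflate nm) -atfM zmodXgE /at_nat mulmxnE.
by rewrite GLvalX Eh circXn.
Qed.

End Lifting.
End Step.
End Period.

Section Count.
Variables d n m M : nat.
Hypotheses (d_pr : prime d) (nm : n.+1 = (d * m.+1)%N) (dM : (d %| M)%N) (M1 : (1 < M)%N).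
Local Notation F := 'F_d.
Local Notation Xn1 n := ('X^(n.+1) - 1 : {poly F}).

Let d0 : (0 < d)%N. Proof. exact: prime_gt0. Qed.
Let d1 : (1 < d)%N. Proof. exact: prime_gt1. Qed.

(** p^d = 1 modulo X^n - 1 = (X^m - 1)^d means that X^m - 1 divides p - 1; the
    cofactor is free modulo (X^m - 1)^(d-1). *)
Lemma card_ptorsion_circulant :
  #|ptorsion d (circulant_group1 n.+1 d)| = (d ^ (m.+1 * d.-1))%N.
Proof.
pose K := (m.+1 * d.-1)%N.
pose f (r : 'rV[F]_K) := circ n (1 + Xn1 m * rVpoly r).
have EX : Xn1 n = Xn1 m * Xn1 m ^+ d.-1 by rewrite (Xn1_exp d_pr nm) -exprS prednK.
have X0 := Xn1_neq0 m d.
have sK : size (Xn1 m ^+ d.-1) = K.+1.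
  by rewrite polySpred ?expf_neq0 // size_exp size_Xn1.
have fI : injective f.
  move=> r s /eqP; rewrite circ_eq opprD addrACA subrr add0r -mulrBr EX.
  rewrite dvdp_mul2l // -raddfB => dv.
  apply/eqP; rewrite -subr_eq0 -[r - s]rVpolyK.
  have -> : rVpoly (r - s) = 0; last by rewrite linear0.
  apply/eqP; apply: contraTT dv => rs; apply/negP => /dvdp_leq -/(_ rs).
  by rewrite sK ltnNge size_poly.
rewrite -(card_imset _ (@GLval_inj n d)).
suff -> : (@GLval n.+1 F) @: ptorsion d (circulant_group1 n.+1 d) = f @: setT.
  by rewrite card_imset // cardsT card_mx card_Fp // mul1n.
apply/setP=> A; apply/imsetP/imsetP=> [[g]|[r _ ->]].
  rewrite inE => /andP[/circulant_group1P[p p1 Eg] /eqP gd] ->.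
  have : Xn1 m %| p - 1.
    rewrite -(Xn1_dvd_exp d_pr nm) expr1n -circ_eq circXn circ1 -Eg -GLvalX gd.
    by apply/eqP.
  move=> /dvdpP[s]; rewrite mulrC => Ep.
  exists (poly_rV (s %% (Xn1 m ^+ d.-1))) => //.
  rewrite Eg; apply/eqP; rewrite /f circ_eq poly_rV_K; last first.
    by rewrite -ltnS -sK ltn_modp expf_neq0.
  rewrite opprD addrA Ep -mulrBr EX dvdp_mul2l //.
  by rewrite {1}(divp_eq s (Xn1 m ^+ d.-1)) addrK dvdp_mull.
rewrite /f; set p := 1 + _.
have p1 : p.[1] = 1.
  by rewrite /p hornerD hornerM !hornerE expr1n subrr mul0r addr0.
have cp : coprimep p (Xn1 n).
  by rewrite (coprimep_Xn1 d_pr nm) coprimep_sym /p [1 + _]addrC mulrC coprimep_addl_mul coprimep1.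
have [g gC Eg] := circulant_lift p1 cp; exists g; last by rewrite Eg.
rewrite inE gC; apply/eqP/GLval_inj; rewrite GLvalX Eg -circXn.
rewrite -[RHS](circ1 n d); apply/eqP.
have := circ_exp_eq d_pr nm p 1; rewrite expr1n => ->.
by rewrite circ_eq /p addrAC subrr add0r dvdp_mulr.
Qed.

(** A function f with d f = 0 vanishes at the multiples of d, and its other
    values are arbitrary elements killed by d. The other residues are written
    d w + i + 1 with w < m and i < d - 1. *)
Lemma card_ptorsion_dual : #|ptorsion d (dune_dual M d n)| = (d ^ (m.+1 * d.-1))%N.
Proof.
pose e := (M %/ d)%N.
have Me : M = (d * e)%N by rewrite mulnC divnK.
have e0 : (0 < e)%N by move: (ltnW M1); rewrite Me muln_gt0 => /andP[].
pose G (c : {ffun 'I_m.+1 * 'I_d.-1 -> 'I_d}) (t : nat) : 'Z_M :=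
  oapp (fun i => (c (inord (t %/ d)%N, i) * e)%:R) 0
       (if (t %% d)%N is k.+1 then insub k else None).
pose f c : 'rV['Z_M]_n.+1 := \row_v G c v.
have G0 c t : (d %| t)%N -> G c t = 0 by rewrite /G /dvdn => /eqP ->.
have G1 c t (i : 'I_d.-1) : (t %% d)%N = i.+1 -> G c t = (c (inord (t %/ d)%N, i) * e)%:R.
  by rewrite /G => ->; rewrite valK.
have fI : injective f.
  move=> c c' /rowP E; apply/ffunP=> -[w i]; pose t := (d * w + i.+1)%N.
  have id : (i.+1 < d)%N by have := ltn_ord i; rewrite ltn_predRL.
  have td : (t %/ d)%N = w by rewrite /t mulnC divnMDl // divn_small // addn0.
  have tm : (t %% d)%N = i.+1 by rewrite /t mulnC modnMDl modn_small.
  have tn : (t < n.+1)%N.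
    by rewrite nm mulnC -ltn_divLR // td ltn_ord.
  have := E (Ordinal tn); rewrite !mxE /= !(G1 _ t i) // td inord_val => /eqP.
  rewrite natZ_eq // !modn_small ?[X in (_ < X)%N]Me ?ltn_pmul2r ?ltn_ord // eqn_pmul2r //.
  by move/eqP/val_inj.
suff -> : ptorsion d (dune_dual M d n) = f @: setT.
  by rewrite card_imset // cardsT card_ffun card_prod !card_ord.
apply/setP=> g; rewrite inE; apply/andP/imsetP => [[/dune_dualP[g0 gd] /eqP gp]|[c _ ->]].
  have gd0 t : at_nat g t *+ d = 0.
    by rewrite /at_nat -mulmxnE -zmodXgE gp mxE.
  have eg t : (e %| val (at_nat g t))%N by apply: (Z_killed M1 d0 dM (gd0 t)).
  have gl t : (val (at_nat g t) %/ e < d)%N.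
    by rewrite ltn_divLR // -Me ltn_Zval.
  exists [ffun wi : 'I_m.+1 * 'I_d.-1 => Ordinal (gl (d * wi.1 + wi.2.+1)%N)] => //.
  apply: eq_at => t; rewrite at_nat_row.
  have -> : at_nat g t = at_nat g (inZp t : 'I_n.+1) by rewrite -at_natE.
  set v : nat := inZp t; case E : (v %% d)%N => [|k].
    by rewrite G0 /dvdn ?E // (divn_eq v d) E addn0 mulnC -gd gd0.
  have kd : (k < d.-1)%N by rewrite ltn_predRL -E ltn_pmod.
  rewrite (G1 _ _ (Ordinal kd)) // ffunE /= inordK; last first.
    by rewrite ltn_divLR // mulnC -nm; apply: ltn_ord.
  by rewrite divnK; [rewrite mulnC -E -divn_eq; apply: natZ_val | apply: eg].
have G2 t : G c t *+ d = 0.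
  case E : (t %% d)%N => [|k]; first by rewrite G0 ?mul0rn // /dvdn E.
  have kd : (k < d.-1)%N by rewrite ltn_predRL -E ltn_pmod.
  rewrite (G1 _ _ (Ordinal kd)) // -mulrnA; apply/eqP; rewrite natZ_eq0 //.
  by rewrite -mulnA [(e * d)%N]mulnC -Me dvdn_mull.
split; last first.
  by apply/eqP; rewrite zmodXgE; apply/rowP=> v; rewrite mulmxnE !mxE G2.
apply/dune_dualP; split=> [|t]; first by rewrite at_nat_row G0 //= mod0n dvdn0.
by rewrite !at_nat_row G2 G0 //= nm -muln_modr dvdn_mulr.
Qed.

End Count.

Section MatchingStep.
Variables d a b M n m : nat.
Hypotheses (d_pr : prime d) (b0 : (0 < b)%N).
Hypothesis EM : M = (d ^ a * (d ^ b - 1))%N.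
Hypothesis M1 : (1 < M)%N.
Hypotheses (nm : n.+1 = (d * m.+1)%N) (nM : (n.+1 %| M)%N).

(** Apart from the properties of [frob_graph], two facts are needed. The
    function chi is not inflated from Z_m, since its value at m is 1/d. And X is
    not a d-th power modulo X^n - 1: differentiating X - p^d = s (X^n - 1) in
    characteristic d, which divides n, gives 1 = s' (X^n - 1). *)
Lemma dual_matching_step : dual_matching d M m -> dual_matching d M n.
Proof.
case=> D [totD chiQ]; have mM := mM nm nM.
have dM : (d %| M)%N by rewrite (dvdn_trans _ nM) // nm dvdn_mulr.
have d0 := prime_gt0 d_pr.
apply: (@lift_iso_of_powers _ _ d d_pr (dune_dual_group M d n)
  (circulant_group1_group n.+1 d) _ _ (frob_graph_group n D) (chi M n) (Qn n.+1 d)).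
- exact: zmod_abelian.
- exact: abelian_circulant1.
- exact: frob_graph_iso.
- by move=> f; apply: frob_graph_fst.
- by move=> h; apply: (frob_graph_snd d_pr b0 EM M1 nm nM totD).
- by rewrite (card_ptorsion_dual d_pr nm) // (card_ptorsion_circulant d_pr nm).
- exact: chi_dual.
- exact: Qn_circulant_group1.
- apply/frob_graphP; exists (chi M m), (Qn m.+1 d), 'X; split=> //=.
  + by rewrite circX.
  + by rewrite hornerX.
  + apply: eq_at => t; rewrite (at_inflate nm) zmodXgE /at_nat mulmxnE -!/(at_nat _ _).
    rewrite !at_chi // -mulrnA -mulnA; congr (1 *+ (_ * _)).
    by apply/eqP; rewrite -(eqn_pmul2r (ltn0Sn m)) divnK // -mulnA -nm divnK.
  by rewrite GLvalX GLval_Qn circXn.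
- apply/negP=> /imsetP[[f' g'] /frob_graphP[f [g [p [fg _ _ /= -> _]]]] /= E].
  have [_ _] := and3P totD.
  have /and3P[pD _ _] := totD.
  have [/dune_dualP[f0 _] _] := partial_iso_sub pD fg.
  have : at_nat (chi M n) m.+1 = 0.
    by rewrite E (at_inflate nm) -[RHS]f0; apply: eq_at_nat; rewrite modnn mod0n.
  rewrite at_chi // => /eqP; rewrite natZ_eq0 //.
  have EMn : M = (n.+1 * (M %/ n.+1))%N by rewrite mulnC divnK.
  have q0 : (0 < M %/ n.+1)%N by rewrite divn_gt0 // dvdn_leq // ltnW.
  move/dvdn_leq; rewrite muln_gt0 q0 => /(_ isT).
  rewrite [X in (X <= _)%N]EMn leq_pmul2r // nm -{2}[m.+1]mul1n leq_pmul2r //.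
  by rewrite leqNgt prime_gt1.
apply/negP=> /imsetP[[f' g'] /frob_graphP[f [g [p [_ _ _ /= _ E]]]] /= EQ].
move: E; rewrite -EQ GLval_Qn => /eqP; rewrite circ_eq => /dvdpP[s Es].
have := congr1 deriv Es; rewrite derivB derivX deriv_exp derivM.
have dF : d%:R = 0 :> {poly 'F_d} by apply: pcharf0; apply: pcharF.
rewrite -mulr_natr dF mulr0 subr0 derivB derivC subr0 derivXn nm.
rewrite -mulr_natr natrM dF mul0r mulr0 mulr0 addr0 => Eu.
have : 'X^(n.+1) - 1 %| (1 : {poly 'F_d}).
  by apply/dvdpP; exists (s^`()); move: Eu; rewrite -nm.
by rewrite dvdp1 size_Xn1.
Qed.
End MatchingStep.

(** * The duality for n prime to d *)

Lemma interpolation (K : fieldType) (s : seq K) (u : K -> K) : uniq s ->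
  exists2 P : {poly K}, (size P <= size s)%N & {in s, forall x, P.[x] = u x}.
Proof.
elim: s => [|x s IH] /=; first by exists 0; rewrite ?size_poly0.
case/andP=> xs /IH[P sP Ps]; pose W := \prod_(y <- s) ('X - y%:P).
have W0 y : y \in s -> W.[y] = 0.
  by move=> ys; apply/eqP; rewrite -[_ == 0]/(root W y) root_prod_XsubC.
have Wx : W.[x] != 0 by rewrite -[_ == 0]/(root W x) root_prod_XsubC.
exists (P + ((u x - P.[x]) / W.[x]) *: W).
  rewrite (leq_trans (size_polyD _ _)) // geq_max (leq_trans sP) //=.
  by rewrite (leq_trans (size_scale_leq _ _)) // size_prod_XsubC.
move=> y; rewrite inE hornerD hornerZ => /predU1P[->|ys].
  by rewrite divfK // addrC subrK.
by rewrite (W0 _ ys) mulr0 addr0 Ps.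
Qed.

(** All nonzero elements are roots of unity, and there are enough of them. *)
Lemma finField_prim_root (K : finFieldType) : exists w : K, (#|K|.-1).-primitive_root w.
Proof.
have K1 := finRing_gt1 K.
have : has (#|K|.-1).-primitive_root (enum (predC1 (0 : K))).
  apply: has_prim_root; rewrite ?enum_uniq -?cardE ?cardC1 //.
    by rewrite -ltnS prednK // ltnW.
  apply/allP=> x; rewrite mem_enum => /= x0; rewrite unity_rootE.
  apply/eqP/(mulfI x0); rewrite -exprS mulr1 prednK ?expf_card // ltnW //.
by case/hasP=> w _ pw; exists w.
Qed.

Section Coprime.
Variables d a b M n : nat.
Hypotheses (d_pr : prime d) (b0 : (0 < b)%N).
Hypothesis EM : M = (d ^ a * (d ^ b - 1))%N.
Hypothesis M1 : (1 < M)%N.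
Hypotheses (nd : ~~ (d %| n.+1)%N) (nM : (n.+1 %| M)%N).

(* K is the field with d^b elements. *)
Variable K : fieldType.
Variable emb : {rmorphism 'F_d -> K}.
Hypothesis embP : forall x : K, x ^+ d = x -> exists c, x = emb c.
Hypothesis cardK : forall x : K, x ^+ (d ^ b) = x.
Variable w : K.
Hypothesis prim_w : (d ^ b - 1).-primitive_root w.

Local Notation q := (d ^ b - 1)%N.
Local Notation F := 'F_d.
Local Notation Xn1 R := ('X^(n.+1) - 1 : {poly R}).

Lemma nq : (n.+1 %| q)%N.
Proof.
have cop : coprime n.+1 (d ^ a) by rewrite coprime_sym coprimeXl // prime_coprime.
by rewrite -(Gauss_dvdr _ cop) -EM.
Qed.

(** The root of unity that [wpow] attaches to 1/n. *)
Definition zeta := w ^+ (M %/ n.+1).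

Lemma prim_zeta : n.+1.-primitive_root zeta.
Proof.
have -> : zeta = (w ^+ (q %/ n.+1)) ^+ (d ^ a).
  by rewrite -exprM /zeta EM -muln_divA ?nq // mulnC.
rewrite prim_root_exp_coprime ?dvdn_prim_root ?nq //.
by rewrite coprimeXl // prime_coprime.
Qed.

(** Since w has order d^b - 1, the map x |-> w^x on Z/M is injective only on
    the multiples of d^a; these contain all values of the dual. *)
Definition wpow (x : 'Z_M) : K := w ^+ val x.

Lemma wM : w ^+ M = 1.
Proof. by rewrite EM mulnC exprM (prim_expr_order prim_w) expr1n. Qed.

Lemma wpow_nat i : wpow i%:R = w ^+ i.
Proof. by rewrite /wpow /= val_Zp_nat // {2}(divn_eq i M) exprD mulnC exprM wM expr1n mul1r. Qed.

Lemma wpowD x y : wpow (x + y) = wpow x * wpow y.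
Proof.
by rewrite {1}(natZ_val x) {1}(natZ_val y) -natrD wpow_nat exprD.
Qed.

Lemma wpow0 : wpow 0 = 1. Proof. by []. Qed.

Lemma wpowMn x k : wpow (x *+ k) = wpow x ^+ k.
Proof. by elim: k => // k IH; rewrite mulrS wpowD IH exprS. Qed.

(** Equality modulo d^b - 1 and modulo d^a gives equality modulo M. *)
Lemma wpow_inj x y : (d ^ a %| val x)%N -> (d ^ a %| val y)%N ->
  wpow x = wpow y -> x = y.
Proof.
move=> dx dy /eqP; rewrite /wpow (eq_prim_root_expr prim_w) => xy.
apply/val_inj/eqP; rewrite -(modn_small (ltn_Zval M1 x)) -(modn_small (ltn_Zval M1 y)).
rewrite [X in (_ %% X)%N]EM [X in _ == (_ %% X)%N]EM chinese_remainder; last first.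
  by rewrite coprimeXl //; apply: coprime_pred_exp.
by rewrite xy andbT; move: dx dy; rewrite /dvdn => /eqP-> /eqP->.
Qed.

Lemma dual_dvd (f : 'rV['Z_M]_n.+1) t :
  f \in dune_dual M d n -> (d ^ a %| val (at_nat f t))%N.
Proof.
move=> fA; have q0 : (0 < q)%N by move: (ltnW M1); rewrite EM muln_gt0 => /andP[].
have := @dune_dual_killed d b M d_pr n 0 f t fA; rewrite mul1n => /(_ nq).
move/(Z_killed M1 q0); have -> : (M %/ q = d ^ a)%N by rewrite EM mulnK.
by apply; rewrite EM dvdn_mull.
Qed.

Definition evz (p : {poly F}) t := (map_poly emb p).[zeta ^+ t].

Lemma evzM p p' t : evz (p * p') t = evz p t * evz p' t.
Proof. by rewrite /evz rmorphM hornerM. Qed.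

Lemma evz_Xn1 t : evz (Xn1 F) t = 0.
Proof.
rewrite /evz rmorphB rmorph1 /= map_polyXn !hornerE -exprM mulnC exprM.
by rewrite (prim_expr_order prim_zeta) expr1n subrr.
Qed.

Lemma evz_frob p t : evz p t ^+ d = evz p (d * t).
Proof.
have pK : d \in [pchar K] by rewrite (fmorph_pchar emb) pchar_Fp.
rewrite /evz -!(pFrobenius_autE pK) -horner_map -map_poly_comp /=.
rewrite pFrobenius_autE -exprM mulnC; congr (_.[_]).
apply: eq_map_poly => c /=; rewrite pFrobenius_autE -rmorphXn /=.
by rewrite -{2}(expf_card c) card_Fp.
Qed.

Lemma roots_zeta : map_poly emb (Xn1 F) = \prod_(0 <= i < n.+1) ('X - (zeta ^+ i)%:P).
Proof. by rewrite (factor_Xn_sub_1 prim_zeta) rmorphB rmorph1 /= map_polyXn. Qed.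

Let zs := [seq zeta ^+ t | t <- iota 0 n.+1].

Lemma uniq_zeta : uniq zs.
Proof.
rewrite map_inj_in_uniq ?iota_uniq // => i j; rewrite !mem_iota /= !add0n => ni nj /eqP.
by rewrite (eq_prim_root_expr prim_zeta) !modn_small // => /eqP.
Qed.

Lemma evz_root0 p : (forall t, evz p t = 0) -> Xn1 F %| p.
Proof.
move=> p0; rewrite -(dvdp_map emb) roots_zeta.
have -> : \prod_(0 <= i < n.+1) ('X - (zeta ^+ i)%:P) = \prod_(z <- zs) ('X - z%:P).
  by rewrite big_map /index_iota subn0.
apply: uniq_roots_dvdp; last by rewrite uniq_rootsE uniq_zeta.
by apply/allP=> _ /mapP[t _ ->]; apply/eqP/p0.
Qed.

Lemma evz_coprime p : (forall t, evz p t != 0) -> coprimep p (Xn1 F).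
Proof.
move=> p0; rewrite -(coprimep_map emb) roots_zeta coprimep_sym.
elim/big_ind: _ => [|x y cx cy|i _]; first by rewrite coprime1p.
  by rewrite coprimepMl cx.
by rewrite coprimep_sym coprimep_XsubC; apply: p0.
Qed.

Lemma coprime_evz p t : coprimep p (Xn1 F) -> evz p t != 0.
Proof.
rewrite -(coprimep_map emb) coprimep_sym => /coprimep_root; apply.
by apply/eqP/evz_Xn1.
Qed.

Lemma evz1 t : evz 1 t = 1. Proof. by rewrite /evz rmorph1 hornerC. Qed.

Lemma evz_0 p : evz p 0 = emb p.[1].
Proof. by rewrite /evz expr0 -(rmorph1 emb) horner_map. Qed.

Lemma evzB p p' t : evz (p - p') t = evz p t - evz p' t.
Proof. by rewrite /evz rmorphB !hornerE. Qed.

Lemma evz_circ p p' t : circ n p = circ n p' -> evz p t = evz p' t.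
Proof.
move/eqP; rewrite circ_eq => /dvdpP[s E].
by apply/eqP; rewrite -subr_eq0 -evzB E evzM evz_Xn1 mulr0.
Qed.

(** The interpolating polynomial P of degree smaller than n is unique. Since
    d f(v) = f(d v), raising its coefficients to the power d yields a polynomial
    with the same values, hence P itself: its coefficients lie in F_d. *)
Lemma dual_interpolation (f : 'rV['Z_M]_n.+1) : f \in dune_dual M d n ->
  exists p, forall t, evz p t = wpow (at_nat f t).
Proof.
move=> /dune_dualP[f0 fd].
have [P sP Pz] := interpolation (fun z => wpow (at_nat f (index z zs))) uniq_zeta.
rewrite size_map size_iota in sP.
have Pf t : P.[zeta ^+ t] = wpow (at_nat f t).
  have tn : (t %% n.+1 < n.+1)%N by rewrite ltn_mod.
  have -> : at_nat f t = at_nat f (t %% n.+1) by apply: eq_at_nat; rewrite modn_mod.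
  rewrite -(prim_expr_mod prim_zeta) Pz; last first.
    by apply/mapP; exists (t %% n.+1)%N; rewrite ?mem_iota.
  have {1}-> : zeta ^+ (t %% n.+1) = nth 0 zs (t %% n.+1).
    by rewrite (nth_map 0%N) ?size_iota // nth_iota.
  by rewrite index_uniq ?uniq_zeta // size_map size_iota.
have pK : d \in [pchar K] by rewrite (fmorph_pchar emb) pchar_Fp.
pose Fr := pFrobenius_aut pK.
have FrP : map_poly Fr P = P.
  apply/eqP; rewrite -subr_eq0; apply/eqP.
  apply: (@roots_geq_poly_eq0 _ _ zs) uniq_zeta _; last first.
    rewrite size_map size_iota (leq_trans (size_polyD _ _)) // geq_max size_polyN sP.
    by rewrite andbT (leq_trans (size_poly _ _)).
  apply/allP=> _ /mapP[t _ ->]; apply/eqP; rewrite hornerD hornerN.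
  (* t' is the quotient of t by d modulo n. *)
  pose t' := (d ^ b.-1 * t)%N.
  have tt : t = d * t' %[mod n.+1].
    rewrite mulnA -expnS prednK //; apply/esym/eqP.
    rewrite eqn_mod_dvd; last by rewrite leq_pmull // expn_gt0 prime_gt0.
    by rewrite -{2}[t]mul1n -mulnBl dvdn_mulr // nq.
  have zt : zeta ^+ t = Fr (zeta ^+ t').
    rewrite /Fr pFrobenius_autE -(exprM zeta t') [(t' * d)%N]mulnC; apply/eqP.
    by rewrite (eq_prim_root_expr prim_zeta); apply/eqP.
  rewrite {1}zt horner_map /= !Pf /Fr pFrobenius_autE -wpowMn fd.
  by rewrite (eq_at_nat _ tt) subrr.
have cP i : exists x, P`_i = emb x.
  apply: embP; rewrite -{2}FrP coef_map_id0 /Fr ?pFrobenius_autE //.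
  by rewrite expr0n /= eqn0Ngt prime_gt0.
exists (\poly_(i < size P) sval (cid (cP i))) => t; rewrite -Pf; congr (_.[_]).
apply/polyP=> i; rewrite coef_map coef_poly.
case: ltnP => iP; first by rewrite /=; case: cid => x /= ->.
by rewrite nth_default //; apply: (rmorph0 emb).
Qed.

(** The scalars evz p t are the eigenvalues of the circulant p(Q_n). *)
Definition eval_graph : {set 'rV['Z_M]_n.+1 * {'GL_n.+1(d)}} :=
  [set z : 'rV['Z_M]_n.+1 * {'GL_n.+1(d)} | `[< exists p,
     [/\ z.1 \in dune_dual M d n, z.2 \in circulant_group1 n.+1 d,
         GLval z.2 = circ n p & forall t, evz p t = wpow (at_nat z.1 t)] >]].

Lemma eval_graphP (z : 'rV['Z_M]_n.+1 * {'GL_n.+1(d)}) : reflect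
  (exists p, [/\ z.1 \in dune_dual M d n, z.2 \in circulant_group1 n.+1 d,
         GLval z.2 = circ n p & forall t, evz p t = wpow (at_nat z.1 t)])
  (z \in eval_graph).
Proof. by rewrite [z \in eval_graph]in_set; apply: asboolP. Qed.

Lemma eval_graph_group_set : group_set eval_graph.
Proof.
apply/group_setP; split.
  apply/eval_graphP; exists 1; rewrite !group1 circ1; split=> // t.
  by rewrite evz1 /at_nat mxE wpow0.
move=> z z' /eval_graphP[p [z1 z2 Ez zp]] /eval_graphP[p' [z1' z2' Ez' zp']].
apply/eval_graphP; exists (p * p'); split; rewrite ?groupM //.
  by rewrite GLvalM Ez Ez' circM.
by move=> t; rewrite evzM zp zp' -wpowD /at_nat mxE.
Qed.

Canonical eval_graph_group := Group eval_graph_group_set.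

Lemma emb_eq1 c : emb c = 1 -> c = 1.
Proof. by move=> e; apply: (fmorph_inj emb); rewrite e rmorph1. Qed.

(** The eigenvalues determine p modulo X^n - 1. They are powers of w, they
    commute with Frobenius, and the one at t = 0 is p(1) = 1; conversely
    [dual_interpolation] realises every such family. *)
Lemma dual_matching_coprime : dual_matching d M n.
Proof.
exists eval_graph_group; split; last first.
  apply/eval_graphP; exists 'X; rewrite chi_dual // Qn_circulant_group1 circX.
  split=> // t; rewrite at_chi // wpow_nat mulnC exprM.
  by rewrite /evz map_polyX hornerX.
apply/and3P; split.
- apply/andP; split.
    by apply/subsetP=> z /eval_graphP[p [z1 z2 _ _]]; rewrite inE z1 z2.
  apply/forall_inP=> -[f g] /eval_graphP[p [/= fA gC Eg pf]].
  apply/eqP; apply/idP/idP => /eqP e.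
    apply/eqP/GLval_inj; rewrite Eg -[RHS](circ1 n d); apply/eqP; rewrite circ_eq.
    by apply: evz_root0 => t; rewrite evzB evz1 pf e /at_nat mxE wpow0 subrr.
  apply/eqP/eq_at => t; rewrite [RHS]mxE; apply: wpow_inj; rewrite ?dvdn0 ?dual_dvd //.
  by rewrite wpow0 -pf -(evz1 t); apply: evz_circ; rewrite -Eg e circ1.
- apply/subsetP=> f fA; have [p pf] := dual_interpolation fA.
  have p1 : p.[1] = 1.
    apply: emb_eq1; rewrite -evz_0 pf.
    by have /dune_dualP[-> _] := fA; apply: wpow0.
  have cp : coprimep p (Xn1 F).
    apply: evz_coprime => t; rewrite pf /wpow expf_neq0 //.
    apply/eqP=> w0; have := prim_expr_order prim_w; rewrite w0 expr0n.
    by rewrite eqn0Ngt (prim_order_gt0 prim_w) => /eqP; rewrite eq_sym oner_eq0.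
  have [g gC Eg] := circulant_lift p1 cp.
  by apply/imsetP; exists (f, g) => //; apply/eval_graphP; exists p.
apply/subsetP=> g gC; have /circulant_group1P[p p1 Eg] := gC.
have cp := circulant_coprime Eg.
have lg t : exists j, evz p t = w ^+ j.
  have [] := prim_rootP prim_w (x := evz p t); last by move=> i ->; exists i.
  apply: (mulfI (coprime_evz t cp)); rewrite -exprS mulr1 subn1 prednK ?cardK //.
  by rewrite expn_gt0 prime_gt0.
pose J t := sval (cid (lg t)); have JP t : evz p t = w ^+ J t by rewrite /J; case: cid.
have dJ k x : x ^+ (d ^ (k * b)) = x :> K.
  by elim: k => [|k IH]; rewrite ?mul0n // mulSn expnD exprM cardK.
(* As x^(d^b) = x in K, the factor d^(a b) leaves the power of w unchanged
   while making the exponent divisible by d^a. *)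
pose f : 'rV['Z_M]_n.+1 := \row_v (d ^ (a * b) * J v)%:R.
have atf t : at_nat f t = (d ^ (a * b) * J (t %% n.+1)%N)%:R by rewrite at_nat_row.
have wf t : wpow (at_nat f t) = evz p t.
  rewrite atf wpow_nat mulnC exprM -JP dJ /evz.
  by rewrite (prim_expr_mod prim_zeta).
have df t : (d ^ a %| val (at_nat f t))%N.
  rewrite atf /= val_Zp_nat // /dvdn modn_dvdm; last by rewrite EM dvdn_mulr.
  by rewrite -/(dvdn _ _) dvdn_mulr // dvdn_exp2l // leq_pmulr.
apply/imsetP; exists (f, g) => //; apply/eval_graphP; exists p; split=> //=.
apply/dune_dualP; split=> [|t].
  by apply: wpow_inj; rewrite ?dvdn0 ?df // wf evz_0 p1 rmorph1 wpow0.
apply: wpow_inj => //; last by rewrite wpowMn !wf evz_frob.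
rewrite (natZ_val (at_nat f t)) -mulrnA /= val_Zp_nat // /dvdn modn_dvdm.
  by rewrite -/(dvdn _ _) dvdn_mulr // df.
by rewrite EM dvdn_mulr.
Qed.

End Coprime.

(** * The duality for every n *)

Section Matching.
Variables d a b M : nat.
Hypotheses (d_pr : prime d) (b0 : (0 < b)%N).
Hypothesis EM : M = (d ^ a * (d ^ b - 1))%N.
Hypothesis M1 : (1 < M)%N.

(** As long as d divides n, [dual_matching_step] reduces n to n/d. *)
Theorem dual_matching_exists n : (n.+1 %| M)%N -> dual_matching d M n.
Proof.
elim/ltn_ind: n => n IH nM; have [/dvdnP[[|m] nm]|nd] := boolP (d %| n.+1)%N => //.
  rewrite mulnC in nm.
  have mn : (m < n)%N by rewrite -ltnS nm ltn_Pmull // prime_gt1.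
  by apply: (dual_matching_step d_pr b0 EM M1 nm nM (IH m mn (mM nm nM))).
have [K0 pK K0b] := pPrimePowerField d_pr b0.
pose K := pPrimeCharType pK.
have [w pw] := finField_prim_root K0.
rewrite K0b -subn1 in pw.
apply: (@dual_matching_coprime d a b M n d_pr b0 EM M1 nd nM K (in_alg K) _ _ w pw).
  move=> x xd; have : root (map_poly (in_alg K) ('X^d - 'X)) x.
    by rewrite /root rmorphB /= map_polyXn map_polyX !hornerE xd subrr.
  have -> : 'X^d - 'X = \prod_(c : 'F_d) ('X - c%:P).
    by rewrite -finField_genPoly card_Fp.
  rewrite rmorph_prod /= /root horner_prod => /eqP/esym/eqP.
  rewrite eq_sym => /prodf_eq0[c _]; rewrite rmorphB /= map_polyX map_polyC /=.
  by rewrite hornerXsubC subr_eq0 => /eqP ->; exists c.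
by move=> x; rewrite -K0b; apply: (@expf_card K0).
Qed.
End Matching.

(** * From integer vectors to circulant matrices *)

(** Take for a the exponent of d in n, and use Euler's theorem for the other
    factor of n. The doubling of the exponent b gives d^b - 1 > 1. *)
Lemma period_exists d n : prime d -> exists a b,
  [/\ (0 < b)%N, (1 < d ^ a * (d ^ b - 1))%N & (n.+1 %| d ^ a * (d ^ b - 1))%N].
Proof.
move=> d_pr; have d1 := prime_gt1 d_pr; have d0 := prime_gt0 d_pr.
have [m cm Em] := pfactor_coprime d_pr (ltn0Sn n).
have m0 : (0 < m)%N by case: m cm Em => // _; rewrite mul0n.
exists (logn d n.+1), (2 * totient m)%N.
have t0 : (0 < totient m)%N by rewrite totient_gt0.
split; first by rewrite muln_gt0.
  apply: (@leq_trans (1 * (d ^ (2 * totient m) - 1))%N); last first.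
    by rewrite leq_mul2r expn_gt0 d0 orbT.
  rewrite mul1n ltn_subRL; apply: leq_trans (_ : 2 ^ 2 <= _)%N => //.
  apply: leq_trans (_ : d ^ 2 <= _)%N; first by rewrite leq_exp2r.
  by rewrite leq_exp2l // leq_pmulr.
rewrite {1}Em mulnC dvdn_mul // -eqn_mod_dvd ?expn_gt0 ?d0 //.
by rewrite mulnC expnM -modnXm Euler_exp_totient // modnXm exp1n.
Qed.

Section DuneOp.
Variables d n : nat.
Implicit Types c : 'cV[int]_n.+1.

Definition dilation : 'M[int]_n.+1 := \matrix_(v, w) (w == inZp (d * v)%N)%:R.

(** The operator c(v) |-> d c(v) - c(d v). *)
Definition dune_op : 'M[int]_n.+1 := d%:R%:M - dilation.

Definition entry c (t : nat) : int := c (inZp t) ord0.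

Lemma entryE c (v : 'I_n.+1) : c v ord0 = entry c v.
Proof. by rewrite /entry valZpK. Qed.

Lemma eq_entry_mod c t t' : t = t' %[mod n.+1] -> entry c t = entry c t'.
Proof. by move=> e; congr (c _ _); apply: val_inj. Qed.

Lemma eq_entry c c' : (forall t, entry c t = entry c' t) -> c = c'.
Proof. by move=> e; apply/colP=> v; rewrite !entryE. Qed.

Lemma entryD c c' t : entry (c + c') t = entry c t + entry c' t.
Proof. by rewrite /entry mxE. Qed.

Lemma entryN c t : entry (- c) t = - entry c t.
Proof. by rewrite /entry mxE. Qed.

Lemma entryZ x c t : entry (x *: c) t = x * entry c t.
Proof. by rewrite /entry mxE. Qed.

Lemma entry_dilationX k c t : entry (dilation ^+ k *m c) t = entry c (d ^ k * t).
Proof.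
have inZpM u : inZp (d * (inZp u : 'I_n.+1))%N = inZp (d * u)%N :> 'I_n.+1.
  by apply: ord_inj; rewrite /= modnMmr.
elim: k t => [|k IH] t; first by rewrite mul1mx mul1n.
rewrite exprS -mulmxA /entry mxE (bigD1 (inZp (d * t)%N)) //= big1 ?addr0 => [|w wv].
  by rewrite mxE inZpM eqxx mul1r -/(entry _ _) IH mulnA -expnSr.
by rewrite mxE inZpM (negbTE wv) mul0r.
Qed.

Lemma entry_dune_op c t : entry (dune_op *m c) t = entry c t *+ d - entry c (d * t).
Proof.
rewrite mulmxBl mul_scalar_mx entryD entryZ -[in RHS]mulr_natl; congr (_ + _).
by rewrite entryN -[dilation]expr1 entry_dilationX expn1.
Qed.

End DuneOp.

Section Hom.
Variables d n : nat.
Hypothesis d_pr : prime d.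
Local Notation B := (dune_op d n).

(** With phi the dilation, phi^(a+b) = phi^a because n divides d^(a+b) - d^a.
    Moreover (d - X) p = d^a (d^b - 1) + X^a - X^(a+b) for a combination p of
    geometric sums. *)
Lemma dune_op_inverse a b : (n.+1 %| d ^ a * (d ^ b - 1))%N -> exists P,
  B *m P = (d ^ a * (d ^ b - 1))%:R%:M /\ P *m B = (d ^ a * (d ^ b - 1))%:R%:M.
Proof.
move=> nM; pose x : {poly int} := d%:R%:P.
pose S k := \sum_(i < k) x ^+ (k.-1 - i) * 'X ^+ i.
pose p := (x ^+ b - 1) * S a + 'X ^+ a * S b.
pose phi := horner_mx (dilation d n).
have EB : B = phi (x - 'X) by rewrite /phi rmorphB /= horner_mx_C horner_mx_X.
have phiM : phi ('X ^+ (a + b)) = phi ('X ^+ a).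
  rewrite /phi !rmorphXn /= horner_mx_X.
  apply/matrixP=> i j.
  suff E k : (dilation d n ^+ k) i j = (j == inZp (d ^ k * i)%N)%:R.
    rewrite !E; congr (_ == _)%:R; apply: val_inj => /=; apply/eqP.
    rewrite eqn_mod_dvd; last by rewrite leq_mul2r leq_pexp2l ?leq_addr ?orbT ?prime_gt0.
    by rewrite -mulnBl expnD -[X in (_ - X)%N]muln1 -mulnBr dvdn_mulr.
  have := @entry_dilationX d n k (delta_mx j 0 : 'cV_n.+1) i; rewrite /entry valZpK => e.
  have -> : (dilation d n ^+ k) i j = (dilation d n ^+ k *m delta_mx j 0) i (ord0 : 'I_1).
    by rewrite -colE mxE.
  by rewrite e mxE eqxx andbT eq_sym.
have E : phi ((x - 'X) * p) = (d ^ a * (d ^ b - 1))%:R%:M.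
  have -> : (x - 'X) * p = x ^+ a * (x ^+ b - 1) + ('X ^+ a - 'X ^+ (a + b)).
    rewrite mulrDr mulrCA -!subrXX [_ * ('X^a * _)]mulrCA -subrXX exprD.
    have ring_id (u v s t : {poly int}) :
        (t - 1) * (u - v) + v * (t - s) = u * (t - 1) + (v - v * s).
      ring.
    exact: ring_id.
  have phi0 : phi ('X ^+ a - 'X ^+ (a + b)) = 0.
    by apply/eqP; rewrite /phi rmorphB subr_eq0; apply/eqP/esym/phiM.
  have phiD u v : phi (u + v) = phi u + phi v by exact: rmorphD.
  rewrite phiD phi0 addr0.
  have -> : x ^+ a * (x ^+ b - 1) = (d ^ a * (d ^ b - 1))%:R%:P.
    by rewrite /x !rmorph_nat natrM natrB ?expn_gt0 ?prime_gt0 // !natrX.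
  by rewrite /phi horner_mx_C.
exists (phi p); rewrite EB -E /phi rmorphM; split=> //.
by rewrite mulmxE -rmorphM mulrC rmorphM.
Qed.

End Hom.

Section Reduction.
Variables M n : nat.
Hypothesis M1 : (1 < M)%N.

Lemma intrZ_eq0 (x : int) : (x%:~R == 0 :> 'Z_M) = (M%:Z %| x)%Z.
Proof.
rewrite /dvdz; case: x => k; first by rewrite -pmulrn natZ_eq0.
by rewrite NegzE mulrNz oppr_eq0 -pmulrn natZ_eq0 // abszN.
Qed.

Definition reduce (c : 'cV[int]_n.+1) : 'rV['Z_M]_n.+1 := \row_v (c v ord0)%:~R.

Lemma at_reduce c t : at_nat (reduce c) t = (entry c t)%:~R.
Proof. by rewrite at_nat_row. Qed.

Lemma reduceD c c' : reduce (c + c') = reduce c + reduce c'.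
Proof. by apply/rowP=> v; rewrite !mxE rmorphD. Qed.

Lemma reduce_eq0 c : reduce c = 0 <-> exists c', c = M%:Z *: c'.
Proof.
split=> [r0|[c' ->]]; last first.
  apply/rowP=> v; rewrite !mxE; apply/eqP.
  by rewrite intrZ_eq0 dvdz_mulr.
exists (\col_v (c v ord0 %/ M)%Z); apply/colP=> v; rewrite !mxE mulrC divzK //.
by rewrite -intrZ_eq0; move/rowP/(_ v): r0; rewrite !mxE => ->.
Qed.

Definition lift_dual (f : 'rV['Z_M]_n.+1) : 'cV[int]_n.+1 := \col_v (val (f ord0 v))%:Z.

Lemma reduce_lift f : reduce (lift_dual f) = f.
Proof. by apply/rowP=> v; rewrite !mxE -pmulrn; apply/esym/natZ_val. Qed.

End Reduction.

Section DuneHom.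
Variables d n : nat.
Hypothesis d_pr : prime d.
Local Notation B := (dune_op d n).
Implicit Types b c : 'cV[int]_n.+1.

(** The coordinate at 0 carries no information, since e_0 = 0 in the sand dune
    group. *)
Definition zero_at0 c : 'cV[int]_n.+1 := \col_v (if v == ord0 then 0 else c v ord0).

Lemma zero_at0_0 c : zero_at0 c ord0 ord0 = 0. Proof. by rewrite mxE. Qed.

Lemma zero_at0_id c : c ord0 ord0 = 0 -> zero_at0 c = c.
Proof. by move=> c0; apply/colP=> v; rewrite mxE; case: eqP => [->|]. Qed.

Lemma zero_at0D c c' : zero_at0 (c + c') = zero_at0 c + zero_at0 c'.
Proof. by apply/colP=> v; rewrite !mxE; case: eqP; rewrite ?addr0. Qed.

Lemma entry0 c : entry c 0 = c ord0 ord0.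
Proof. by rewrite -[0%N]/(nat_of_ord (ord0 : 'I_n.+1)) -entryE. Qed.

Lemma dune_op0 c : (B *m c) ord0 ord0 = c ord0 ord0 *+ d.-1.
Proof.
rewrite -(entry0 (B *m c)) entry_dune_op muln0 entry0 -subn1 mulrnBr ?prime_gt0 //.
Qed.

Lemma dune_op0_eq0 c : (B *m c) ord0 ord0 = 0 -> c ord0 ord0 = 0.
Proof.
rewrite dune_op0 => /eqP; rewrite mulrn_eq0 => /orP[|/eqP//].
by rewrite -subn1 subn_eq0 leqNgt prime_gt1.
Qed.

(** The image of v |-> v/n under [dune_op]. *)
Definition carry : 'cV[int]_n.+1 := \col_v (d * v %/ n.+1)%N%:Z.

(** If b 0 = 0, the rational solution of B psi = b vanishing at 0 is P b / M.
    Modulo Z it is an element of the dual, which is trivial exactly when psi is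
    integral, and every element of the dual arises in this way. The map h is its
    composition with the duality. *)
Theorem dune_hom : exists h : 'cV[int]_n.+1 -> {'GL_n.+1(d)},
  [/\ forall b c, h (b + c) = (h b * h c)%g,
      forall b, h b = h (zero_at0 b),
      forall g, g \in circulant_group1 n.+1 d <->
                exists2 b : 'cV[int]_n.+1, b ord0 ord0 = 0 & h b = g,
      forall b, b ord0 ord0 = 0 ->
         (h b = 1%g <-> exists2 c : 'cV[int]_n.+1, c ord0 ord0 = 0 & b = B *m c)
    & h carry = Qn n.+1 d].
Proof.
have [a [k [k0 M1 nM]]] := period_exists n d_pr.
have [P [BP PB]] := dune_op_inverse d_pr nM.
set M := (d ^ a * (d ^ k - 1))%N in M1 nM BP PB.
have [D [totD chiQ]] := dual_matching_exists d_pr k0 (erefl M) M1 nM.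
have /and3P[pD /subsetP sD1 /subsetP sD2] := totD.
have M0 : M%:Z != 0 by rewrite -lt0n ltnW.
have BPc c : B *m (P *m c) = M%:Z *: c by rewrite mulmxA BP mul_scalar_mx -natz.
have PBc c : P *m (B *m c) = M%:Z *: c by rewrite mulmxA PB mul_scalar_mx -natz.
have MI b c : M%:Z *: b = M%:Z *: c -> b = c.
  move/colP=> e; apply/colP=> v; have := e v; rewrite !mxE; exact: mulfI.
have P0 b : b ord0 ord0 = 0 -> (P *m b) ord0 ord0 = 0.
  by move=> b0; apply: dune_op0_eq0; rewrite BPc mxE b0 mulr0.
have reduceA b : b ord0 ord0 = 0 -> reduce M (P *m b) \in dune_dual M d n.
  move=> b0; apply/dune_dualP; split=> [|t]; first by rewrite at_reduce entry0 P0.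
  rewrite !at_reduce -rmorphMn /=; apply/eqP; rewrite -subr_eq0 -rmorphB /=.
  rewrite -entry_dune_op BPc entryZ intrZ_eq0 //; exact: dvdz_mulr.
pose theta f := odflt 1%g [pick g | (f, g) \in D].
have thetaP f : f \in dune_dual M d n -> (f, theta f) \in D.
  move=> fA; rewrite /theta; case: pickP => //= no.
  by have /imsetP[[f' g] fg /= e] := sD1 f fA; rewrite -e in fg; rewrite no in fg.
have theta_eq f g : (f, g) \in D -> theta f = g.
  move=> fg; apply: (partial_iso_inj1 pD _ fg); apply: thetaP.
  by case: (partial_iso_sub pD fg).
pose h b := theta (reduce M (P *m zero_at0 b)).
have hE b : b ord0 ord0 = 0 -> h b = theta (reduce M (P *m b)).
  by move=> /zero_at0_id e; rewrite /h e.
exists h; split.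
- move=> b c; apply: theta_eq; rewrite zero_at0D mulmxDr reduceD.
  by apply: (groupM (thetaP _ _) (thetaP _ _)); apply: reduceA; apply: zero_at0_0.
- by move=> b; rewrite [RHS]hE ?zero_at0_0.
- move=> g; split=> [gC|[b b0 <-]]; last first.
    rewrite hE //; by case: (partial_iso_sub pD (thetaP _ (reduceA b b0))).
  have /imsetP[[f g'] fg /= e] := sD2 g gC; rewrite -{}e in fg.
  have [/= /dune_dualP[f0 fd] _] := partial_iso_sub pD fg.
  have [b Eb] : exists b, B *m lift_dual f = M%:Z *: b.
    apply/reduce_eq0 => //; apply: eq_at => t; rewrite at_reduce entry_dune_op rmorphB rmorphMn /=.
    by rewrite -!at_reduce reduce_lift // fd subrr [RHS]mxE.
  have l0 : lift_dual f ord0 ord0 = 0.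
    by rewrite mxE; move: f0; rewrite -[0%N]/(nat_of_ord (ord0 : 'I_n.+1)) -at_natE => ->.
  have Pb : P *m b = lift_dual f.
    by apply: MI; rewrite scalemxAr -Eb PBc.
  have b0 : b ord0 ord0 = 0.
    apply: (mulfI M0); rewrite mulr0; have := dune_op0 (lift_dual f).
    by rewrite l0 mul0rn Eb mxE.
  by exists b => //; rewrite hE // Pb reduce_lift //; apply: theta_eq.
- move=> b b0; rewrite hE //.
  have := partial_iso1 pD (thetaP _ (reduceA b b0)) => /= e.
  split=> [h1|[c c0 Eb]].
    have /eqP : reduce M (P *m b) == 0 by rewrite -[_ == 0]/(_ == 1%g) e h1.
    move/(reduce_eq0 M1) => [c Ec].
    exists c; last by apply: MI; rewrite -BPc Ec scalemxAr.
    by apply: (mulfI M0); rewrite mulr0 -(P0 b b0) Ec mxE.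
  apply/eqP; rewrite -e -[_ == 1%g]/(_ == 0); apply/eqP/reduce_eq0 => //.
  by exists c; rewrite Eb PBc.
pose psi : 'cV[int]_n.+1 := \col_v (v * (M %/ n.+1))%N%:Z.
have Bpsi : B *m psi = M%:Z *: carry.
  apply: eq_entry => t; rewrite entry_dune_op entryZ /entry !mxE /=.
  rewrite -modnMmr; set v := (t %% n.+1)%N; set e := (M %/ n.+1)%N.
  have Me : M = (n.+1 * e)%N by rewrite mulnC divnK.
  apply/eqP; rewrite subr_eq -!natz -mulrnA -natrM -natrD eqr_nat; apply/eqP.
  rewrite mulnAC [(v * d)%N]mulnC [X in (X * e)%N](divn_eq (d * v) n.+1) mulnDl.
  by rewrite Me -mulnA mulnC -!mulnA.
have c0 : carry ord0 ord0 = 0 by rewrite mxE muln0 div0n.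
rewrite hE //.
have -> : P *m carry = psi by apply: MI; rewrite scalemxAr -Bpsi PBc.
apply: theta_eq; suff -> : reduce M psi = chi M n by [].
by apply/rowP=> v; rewrite !mxE -pmulrn.
Qed.

End DuneHom.

(** * The sand dune group *)

Section CycRing.
Variables n d : nat.
Local Notation R := (cycring n.+1).
Local Notation Xn1 := ('X^(n.+1) - 1 : {poly int}).
Local Notation cx := (@cx n.+1).

Lemma mk_Xn1 : mk_monic Xn1 = Xn1.
Proof. by rewrite /mk_monic size_XnsubC // monicXnsubC. Qed.

Definition ccol (a : R) : 'cV[int]_n.+1 := \col_v (val a : {poly int})`_v.

Lemma ccolD a b : ccol (a + b) = ccol a + ccol b.
Proof. by apply/colP=> v; rewrite !mxE coefD. Qed.
Lemma ccol0 : ccol 0 = 0.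
Proof. by apply/colP=> v; rewrite !mxE coef0. Qed.
Lemma ccolN a : ccol (- a) = - ccol a.
Proof. by apply/colP=> v; rewrite !mxE coefN. Qed.
Lemma ccolMn a k : ccol (a *+ k) = ccol a *+ k.
Proof. by elim: k => [|k IH]; rewrite ?mulr0n ?ccol0 // !mulrS ccolD IH. Qed.
Lemma ccolMz a z : ccol (a *~ z) = ccol a *~ z.
Proof. by case: z => k; rewrite ?NegzE ?mulrNz ?ccolN -!pmulrn ccolMn. Qed.

Lemma size_cyc (a : R) : (size (val a : {poly int}) <= n.+1)%N.
Proof.
by rewrite -ltnS (leq_trans (size_mk_monic a)) // mk_Xn1 size_XnsubC.
Qed.

Lemma ccol_inj : injective ccol.
Proof.
move=> a b /colP e; apply/val_inj/polyP=> i.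
have [ni|ni] := ltnP i n.+1; first by have := e (Ordinal ni); rewrite !mxE.
by rewrite !nth_default // (leq_trans _ ni) // size_cyc.
Qed.

Lemma ccol_in_qpoly (p : {poly int}) : (size p <= n.+1)%N ->
  ccol (in_qpoly Xn1 p) = \col_v p`_v.
Proof.
move=> sp; apply/colP=> v; rewrite !mxE; congr ((polyseq _)`_v).
by apply: in_qpoly_small; rewrite mk_Xn1 size_XnsubC.
Qed.

Lemma ccol_surj c : exists a, ccol a = c.
Proof.
exists (in_qpoly Xn1 (\poly_(i < n.+1) entry c i)).
rewrite ccol_in_qpoly ?size_poly //; apply/colP=> v; rewrite mxE.
by rewrite coef_poly ltn_ord -entryE.
Qed.

Lemma eval1_ccol a : eval1 a = \sum_v ccol a v ord0.
Proof.
rewrite /eval1 (horner_coef_wide _ (size_cyc a)).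
by apply: eq_bigr => v _; rewrite expr1n mulr1 mxE.
Qed.

Definition eps (t : nat) : 'cV[int]_n.+1 := delta_mx (inZp t) ord0.

Lemma cxE k : cx ^+ k = in_qpoly Xn1 'X^k.
Proof.
elim: k => [|k IH]; first by rewrite !expr0 in_qpoly1.
have e : 'X^(k.+1) = 'X * 'X^k :> {poly int} by rewrite exprS.
rewrite [LHS]exprS IH e; apply: esym; exact: in_qpolyM.
Qed.

Lemma cx_exp : cx ^+ n.+1 = 1.
Proof.
have e : 'X^(n.+1) = Xn1 + 1 by rewrite subrK.
rewrite cxE [X in in_qpoly _ X]e in_qpolyD in_qpoly1.
have -> : in_qpoly Xn1 Xn1 = 0; last by rewrite add0r.
apply: val_inj; rewrite /= mk_Xn1; apply: Pdiv.RingMonic.rmodpp; exact: monicXnsubC.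
Qed.

Lemma ccolX k : ccol (cx ^+ k) = eps k.
Proof.
rewrite (divn_eq k n.+1) exprD mulnC exprM cx_exp expr1n mul1r cxE.
rewrite ccol_in_qpoly ?size_polyXn ?ltn_mod //; apply/colP=> v.
by rewrite !mxE coefXn andbT -val_eqE /= mulnC modnMDl modn_mod.
Qed.

(** The coordinates of d x^t - x^(d t), which equals d e_t - e_(d t) up to a
    multiple of x^0. *)
Definition dune_row t : 'cV[int]_n.+1 := eps t *+ d - eps (d * t).

(** The sum in f_v is geometric: multiplied by x - 1 it collapses. *)
Lemma ccol_dune_gen (v : 'I_n.+1) :
  ccol (val (dune_gen d v)) = dune_row v.+1 - dune_row v.
Proof.
have -> : val (dune_gen d v) = (cx ^+ v.+1 *+ d - cx ^+ (d * v.+1)) -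
     (cx ^+ v *+ d - cx ^+ (d * v)).
  rewrite /= /fv mulrBr mulrnAr mulrCA -subrX1 mulrBl mul1r -exprS.
  rewrite mulrBr mulr1 -exprD mulnS [(d + _)%N]addnC mulrnBl.
  by rewrite !opprD !addrA !opprK; congr (_ + _); rewrite addrAC.
by rewrite !(ccolD, ccolN, ccolMn) !ccolX.
Qed.

End CycRing.

Section SandDune.
Variables n d : nat.
Hypothesis d_pr : prime d.
Local Notation B := (dune_op d n).
Local Notation eps := (@eps n).
Local Notation dune_row := (@dune_row n d).

(** Its rows are the relations d x^v = x^(d v) and x^0 = 0. They present the
    sand dune group, because the augmentation ideal is a complement of the
    multiples of x^0. *)
Definition dune_mx : 'M[int]_n.+1 :=
  \matrix_(v, w) if (v == ord0) || (w == ord0) then (v == w)%:R else B v w.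

Lemma dune_mx_mul c v :
  (dune_mx *m c) v ord0 = if v == ord0 then c ord0 ord0 else (B *m zero_at0 c) v ord0.
Proof.
rewrite mxE; case: eqP => [->|/eqP v0].
  rewrite (bigD1 ord0) //= big1 ?addr0 ?mxE ?mul1r // => w /negbTE w0.
  by rewrite !mxE /= eq_sym w0 mul0r.
rewrite mxE; apply: eq_bigr => w _; rewrite [dune_mx v w]mxE (negbTE v0) /= [zero_at0 c w _]mxE.
by case: eqP => // ->; rewrite (negbTE v0) mul0r mulr0.
Qed.

Lemma eps_mod t t' : t = t' %[mod n.+1] -> eps t = eps t'.
Proof. by move=> e; congr delta_mx; apply: ord_inj. Qed.

Lemma tr_dune_mx_eps0 : dune_mx^T *m eps 0 = eps 0.
Proof.
rewrite /eps -colE; apply/colP=> v; rewrite !mxE.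
have -> : inZp 0 = ord0 :> 'I_n.+1 by apply: ord_inj.
by rewrite eqxx /= andbT eq_sym.
Qed.

Lemma dune_row0 : dune_row 0 = (d%:R - 1) *: eps 0.
Proof. by rewrite /dune_row muln0 scalerBl scale1r scaler_nat. Qed.

Lemma dune_row_mod t t' : t = t' %[mod n.+1] -> dune_row t = dune_row t'.
Proof.
move=> e; rewrite /dune_row (eps_mod e); congr (_ - _); apply: eps_mod.
by rewrite -modnMmr e modnMmr.
Qed.

Lemma dune_rowE t : exists z : int, dune_row t = dune_mx^T *m eps t + z *: eps 0.
Proof.
have [t0|t0] := eqVneq (inZp t : 'I_n.+1) ord0.
  exists (d%:R - 2%:R); have t0' : t = 0 %[mod n.+1].
    by have := congr1 val t0; rewrite /= mod0n.
  rewrite (dune_row_mod t0') (eps_mod t0') tr_dune_mx_eps0 dune_row0.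
  by rewrite -[X in _ = X + _]scale1r -scalerDl; congr (_ *: _); ring.
exists (- (inZp (d * t)%N == ord0 :> 'I_n.+1)%:R).
rewrite {2}/eps -colE; apply/colP=> v; rewrite !mxE (negbTE t0) /=.
have -> : inZp 0 = ord0 :> 'I_n.+1 by apply: ord_inj.
have E : inZp (d * (t %% n.+1))%N = inZp (d * t)%N :> 'I_n.+1.
  by apply: ord_inj; rewrite /= modnMmr.
have o1 : (0 == ord0 :> 'I_1) = true by [].
rewrite mulmxnE mxE o1 !andbT; have [->|v0] := eqVneq v ord0.
  by rewrite mulr1 [_ == inZp t]eq_sym (negbTE t0) mul0rn [_ == inZp _]eq_sym.
by rewrite mulr0 addr0 E [v == inZp t]eq_sym mulrnAC.
Qed.

Lemma dune_row_im t : exists w, dune_row t = dune_mx^T *m w.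
Proof.
have [z ->] := dune_rowE t; exists (eps t + z *: eps 0).
by rewrite mulmxDr -scalemxAr tr_dune_mx_eps0.
Qed.

Local Notation gens := [seq dune_gen d v | v <- enum 'I_n.+1 & val v != 0%N].

Lemma aug_sum (x : augZ n.+1) : \sum_v ccol (val x) v ord0 = 0.
Proof. by rewrite -eval1_ccol; apply/eqP/(valP x). Qed.

Lemma sum_eps0 (z : int) : \sum_v (z *: eps 0) v ord0 = z.
Proof.
rewrite (bigD1 ord0) //= big1 ?addr0 => [|v /negbTE v0].
  rewrite !mxE; have -> : inZp 0 = ord0 :> 'I_n.+1 by apply: ord_inj.
  by rewrite eqxx mulr1.
rewrite !mxE; have -> : inZp 0 = ord0 :> 'I_n.+1 by apply: ord_inj.
by rewrite v0 mulr0.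
Qed.

(** A multiple of x^0 in the augmentation ideal is 0. *)
Lemma augZ_inj (x y : augZ n.+1) z :
  ccol (val x) = ccol (val y) + z *: eps 0 -> x = y.
Proof.
move=> e; apply/val_inj/ccol_inj; rewrite e.
suff -> : z = 0 by rewrite scale0r addr0.
have : \sum_v (ccol (val y) v ord0 + (z *: eps 0) v ord0) = 0.
  by rewrite -[RHS](aug_sum x) e; apply: eq_bigr => v _; rewrite [RHS]mxE.
by rewrite big_split /= aug_sum sum_eps0 add0r.
Qed.

(** The element d e_t - e_(d t), as a telescoping sum of generators. *)
Definition dune_partial_sum (t : nat) : augZ n.+1 := \sum_(i < t) dune_gen d (inZp i).

Lemma ccol_dune_partial_sum t : ccol (val (dune_partial_sum t)) = dune_row t - dune_row 0.
Proof.
rewrite /dune_partial_sum; elim: t => [|t IH].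
  by rewrite big_ord0 subrr ccol0.
rewrite big_ord_recr /= ccolD IH ccol_dune_gen addrC.
have -> : dune_row (inZp t : 'I_n.+1).+1 = dune_row t.+1.
  by apply: dune_row_mod; rewrite /= -addn1 modnDml addn1.
have -> : dune_row (inZp t : 'I_n.+1) = dune_row t.
  by apply: dune_row_mod; rewrite /= modn_mod.
by rewrite addrA subrK.
Qed.

(** The generator left out at v = 0 is minus the sum of the others, as the sum
    over a whole period telescopes to 0. *)
Lemma dune_gen_span (v : 'I_n.+1) : dune_gen d v \in int_span gens.
Proof.
have Gv (w : 'I_n.+1) : w != ord0 -> dune_gen d w \in int_span gens.
  move=> w0; apply/mem_int_span/map_f; rewrite mem_filter mem_enum inE andbT.
  exact: w0.
have [->|/Gv//] := eqVneq v ord0.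
have tel0 : dune_partial_sum n.+1 = 0.
  apply: (@augZ_inj _ _ 0); rewrite ccol_dune_partial_sum scale0r addr0 ccol0.
  by rewrite (@dune_row_mod n.+1 0) ?subrr // modnn mod0n.
rewrite /dune_partial_sum big_ord_recl /= in tel0.
have o0 : inZp 0 = ord0 :> 'I_n.+1 by apply: ord_inj.
move/eqP: tel0; rewrite o0 addr_eq0 => /eqP ->.
rewrite rpredN rpred_sum // => i _; apply: Gv.
by rewrite -val_eqE /= modn_small // /bump ltnS.
Qed.

(** Replace each row of [dune_mx] by the corresponding sum of generators. Away
    from x^0 nothing changes, and an element of the augmentation ideal is
    determined by its coordinates away from x^0. *)
Lemma span_of_im (x : augZ n.+1) w :
  ccol (val x) = dune_mx^T *m w -> x \in int_span gens.
Proof.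
move=> e; pose y := \sum_(v < n.+1) dune_partial_sum v *~ w v ord0.
have ys : y \in int_span gens.
  by apply: rpred_sum => v _; apply/rpredMz/rpred_sum => i _; apply: dune_gen_span.
suff -> : x = y by [].
pose z := \sum_(v < n.+1) w v ord0 * ((d%:R - 1) - sval (cid (dune_rowE v))).
apply: (@augZ_inj _ _ z); rewrite e.
have -> : w = \sum_(v < n.+1) w v ord0 *: eps v.
  apply/colP=> v; rewrite summxE (bigD1 v) //= big1 ?addr0 => [|u uv].
    by rewrite !mxE valZpK eqxx mulr1.
  by rewrite !mxE valZpK eq_sym (negbTE uv) mulr0.
rewrite mulmx_sumr scaler_suml.
have -> : ccol (val y) = \sum_(v < n.+1) ccol (val (dune_partial_sum v)) *~ w v ord0.
  rewrite /y; elim/big_rec2: _ => [|v a b _ <-]; first by rewrite ccol0.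
  by rewrite ccolD; congr (_ + _); rewrite -ccolMz; congr ccol; rewrite raddfMz.
rewrite -big_split /=; apply: eq_bigr => v _.
rewrite -scalemxAr ccol_dune_partial_sum; case: cid => zv /= ->; rewrite dune_row0.
rewrite -scaler_int intz -addrA -scalerBl scalerDr scalerA -addrA -scalerDl.
rewrite [X in _ = _ + X *: _](_ : _ = 0) ?scale0r ?addr0 //; ring.
Qed.

Lemma dune_kernel (h : 'cV[int]_n.+1 -> {'GL_n.+1(d)}) :
    (forall b, h b = h (zero_at0 b)) ->
    (forall b : 'cV[int]_n.+1, b ord0 ord0 = 0 ->
       (h b = 1%g <-> exists2 c : 'cV[int]_n.+1, c ord0 ord0 = 0 & b = B *m c)) ->
  forall b, h b = 1%g <-> exists c, b = dune_mx *m c.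
Proof.
move=> h0 hker b; rewrite h0 hker ?mxE //; split=> [[c c0 e]|[c ->]].
  exists (c + b ord0 ord0 *: delta_mx ord0 ord0); apply/colP=> v; rewrite dune_mx_mul.
  have -> : zero_at0 (c + b ord0 ord0 *: delta_mx ord0 ord0) = c.
    apply/colP=> u; rewrite !mxE; case: eqP => [->|_] /=.
      by rewrite c0.
    by rewrite mulr0 addr0.
  by rewrite -e !mxE c0 add0r mulr1; case: eqP => [->|].
exists (zero_at0 c); first exact: zero_at0_0.
apply/colP=> v; rewrite [LHS]mxE dune_mx_mul; case: eqP => // ->.
by rewrite dune_op0 // zero_at0_0 mul0rn.
Qed.

(** [dune_hom] identifies C'(n,d) with the cokernel of [dune_mx] on columns,
    and the sand dune group is its cokernel on rows. *)
Theorem sand_dune_isog : zmod_isog (sand_dune_group n.+1 d) (circulant_group1 n.+1 d).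
Proof.
have [h [hD h0 hG hker _]] := dune_hom n d_pr.
have {}hker := dune_kernel h0 hker.
have [U [V [uU uV UV]]] := tr_equivalent dune_mx.
have h1 w : h (U *m (dune_mx^T *m w)) = 1%g.
  by apply/hker; exists (V *m w); rewrite !mulmxA UV.
pose k (x : augZ n.+1) := h (U *m ccol (val x)).
have kD x y : k (x + y) = (k x * k y)%g by rewrite /k ccolD mulmxDr hD.
apply: (zquot_isog kD) => [x|g].
  split=> [/hker[c e]|].
    apply: (@span_of_im x (invmx V *m c)); rewrite -(mulKmx uU (ccol _)) e.
    by rewrite -{1}(mulKVmx uV c) !mulmxA -[_ *m _ *m V]mulmxA -UV !mulmxA mulVmx // mul1mx.
  apply: hom_int_span => // _ /mapP[v _ ->]; rewrite /k ccol_dune_gen.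
  have [w ->] := dune_row_im v.+1; have [w' ->] := dune_row_im v.
  by rewrite -mulmxBr h1.
rewrite hG; split=> [[b b0 <-]|[x <-]]; last first.
  exists (zero_at0 (U *m ccol (val x))); first exact: zero_at0_0.
  by rewrite -h0.
pose c := invmx U *m b; pose z := \sum_v c v ord0.
have [a ea] := ccol_surj (c - z *: eps 0).
have aA : a \in @aug n.+1.
  rewrite unfold_in eval1_ccol ea; apply/eqP.
  rewrite (eq_bigr (fun v => c v ord0 - (z *: eps 0) v ord0)); last first.
    by move=> v _; rewrite [LHS]mxE; congr (_ + _); rewrite [LHS]mxE.
  by rewrite sumrB sum_eps0 subrr.
exists (exist (fun q => q \in @aug n.+1) a aA : augZ n.+1).
rewrite /k /= ea mulmxBr hD mulKVmx // -[RHS]mulg1; congr (_ * _)%g.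
by rewrite -mulmxN -scaleNr -tr_dune_mx_eps0 scalemxAr h1.
Qed.

End SandDune.

(** * The sandpile group *)

Lemma row_spanP n (A : 'M[int]_n) (x : 'rV[int]_n) :
  x \in int_span [seq row v A | v : 'I_n] <-> exists w, x^T = A^T *m w.
Proof.
split=> [/asboolP[a ->]|[w e]].
  apply: (big_ind (fun x => exists w, x^T = A^T *m w)) => [|x1 x2 [w1 e1] [w2 e2]|i _].
  - by exists 0; rewrite mulmx0 trmx0.
  - by exists (w1 + w2); rewrite mulmxDr -e1 -e2 linearD.
  have /mapP[v _ ->] := mem_nth 0 (ltn_ord i).
  exists (a i *: delta_mx v 0); rewrite -scalemxAr -colE -tr_row -scaler_int intz.
  by rewrite linearZ.
have -> : x = \sum_v w v 0 *: row v A.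
  rewrite -[x]trmxK e trmx_mul trmxK mulmx_sum_row.
  by apply: eq_bigr => v _; rewrite mxE.
apply: rpred_sum => v _; rewrite -[w v 0]intz scaler_int; apply/rpredMz.
by apply/mem_int_span/map_f; rewrite mem_enum.
Qed.

Section Laplacian.
Variables n d : nat.
Hypothesis d_pr : prime d.
Local Notation G := (DB n.+1 d).
Local Notation L := (laplacian G).

(** The edge from u with label i is numbered d u + i. The numbers fill the
    interval from 0 to n d, and those of the edges ending at v are v + n j with
    j < d. *)
Lemma indegree_DB v : indegree G v = d.
Proof.
have d0 := prime_gt0 d_pr.
have e1 (j : 'I_d) : ((v + n.+1 * j) %/ d < n.+1)%N.
  rewrite ltn_divLR // (leq_trans (_ : _ < n.+1 * j.+1)%N) ?leq_mul2l ?ltn_ord //.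
  by rewrite mulnS ltn_add2r.
have e2 (j : 'I_d) : ((v + n.+1 * j) %% d < d)%N by rewrite ltn_mod.
pose f (j : 'I_d) : edge G := (Ordinal (e1 j), Ordinal (e2 j)).
have fE j : (d * (f j).1 + (f j).2 = v + n.+1 * j)%N by rewrite /= mulnC -divn_eq.
have fI : injective f.
  move=> i j e; apply: ord_inj; have := fE i; rewrite e fE => /eqP.
  by rewrite eqn_add2l eqn_pmul2l // eq_sym => /eqP.
rewrite /indegree -[RHS]card_ord -(card_imset predT fI); apply: eq_card => -[u i].
rewrite inE; apply/eqP/imsetP => [ev|[j _ ->]]; last first.
  apply: ord_inj; rewrite [LHS]/= -[X in (X %% _)%N]/(d * (f j).1 + (f j).2)%N fE.
  by rewrite addnC mulnC modnMDl modn_small.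
have tv : ((d * u + i) %% n.+1 = v)%N by rewrite -ev.
have jd : ((d * u + i) %/ n.+1 < d)%N.
  rewrite ltn_divLR // (leq_trans (_ : _ < d * u.+1)%N) ?leq_mul2l ?ltn_ord ?orbT //.
  by rewrite mulnS [(d + _)%N]addnC ltn_add2l.
exists (Ordinal jd) => //.
have E : (v + n.+1 * ((d * u + i) %/ n.+1) = d * u + i)%N.
  by rewrite -tv addnC mulnC -divn_eq.
congr pair; apply: ord_inj => /=; rewrite E.
  by rewrite mulnC divnMDl // divn_small // addn0.
by rewrite mulnC modnMDl modn_small.
Qed.

Lemma entry_laplacian (c : 'cV[int]_n.+1) t :
  entry (L *m c) t = entry c t *+ d - \sum_(i < d) entry c (d * t + i).
Proof.
rewrite mulmxBl entryD entryN; congr (_ - _).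
  rewrite /entry mul_diag_mx !mxE indegree_DB.
  by rewrite -natz mulr_natl.
rewrite /entry mxE; set v := inZp t.
have -> : \sum_(i < d) c (inZp (d * t + i)) ord0 = \sum_(i < d) c (tgt ((v, i) : edge G)) ord0.
  apply: eq_bigr => i _; congr (c _ _); apply: ord_inj => /=.
  by rewrite /v /= -[RHS]modnDml modnMmr modnDml.
transitivity (\sum_w \sum_(e : edge G | (src e == v) && (tgt e == w)) c (tgt e) ord0).
  apply: eq_bigr => w _; rewrite mxE.
  rewrite (eq_bigr (fun=> c w ord0)) => [|e /andP[_ /eqP->] //].
  rewrite sumr_const mulrC -mulr_natr natz; congr (_ * _%:Z).
  by apply: eq_card => e; rewrite inE.
rewrite (exchange_big_dep (fun e : edge G => src e == v)) /=; last by move=> w e _ /andP[].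
rewrite (eq_bigr (fun e : 'I_n.+1 * 'I_d => c (tgt ((e.1, e.2) : edge G)) ord0)); last first.
  move=> -[u i] /= uv; rewrite uv; rewrite (big_pred1 (tgt ((u, i) : edge G))) // => w.
  by rewrite eq_sym.
rewrite (eq_bigl (fun e : 'I_n.+1 * 'I_d => (e.1 == v) && true)) => [|e]; last by rewrite andbT.
rewrite -(pair_big (fun u => u == v) predT (fun u i => c (tgt ((u, i) : edge G)) ord0)) /=.
by rewrite big_pred1_eq.
Qed.

Definition cumsum (c : 'cV[int]_n.+1) (t : nat) : int := \sum_(j < t) entry c j.

Lemma cumsumD c s k : cumsum c (s + k) = cumsum c s + \sum_(i < k) entry c (s + i).
Proof. by rewrite /cumsum big_split_ord. Qed.

Lemma cumsumS c t : cumsum c t.+1 = cumsum c t + entry c t.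
Proof. by rewrite /cumsum big_ord_recr. Qed.

Lemma cumsum_additive c c' t : cumsum (c + c') t = cumsum c t + cumsum c' t.
Proof. by rewrite /cumsum -big_split; apply: eq_bigr => i _; rewrite entryD. Qed.

Lemma cumsum_laplacian c t : cumsum (L *m c) t = cumsum c t *+ d - cumsum c (d * t).
Proof.
elim: t => [|t IH]; first by rewrite muln0 /cumsum !big_ord0 mul0rn subrr.
rewrite !cumsumS IH entry_laplacian mulnS [(d + _)%N]addnC cumsumD mulrnDl.
by rewrite opprD addrACA.
Qed.

Lemma cumsum_period c q t :
  cumsum c (q * n.+1 + t) = cumsum c n.+1 *+ q + cumsum c t.
Proof.
have step u : cumsum c (n.+1 + u) = cumsum c n.+1 + cumsum c u.
  rewrite cumsumD; congr (_ + _); apply: eq_bigr => i _.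
  by apply: eq_entry_mod; rewrite modnDl.
elim: q => [|q IH]; first by rewrite mul0n add0n mulr0n add0r.
by rewrite mulSn -addnA step IH mulrS addrA.
Qed.

(** The inverse of taking differences, which on the dual side corresponds to
    multiplication by x - 1. *)
Definition antidiff c : 'cV[int]_n.+1 := \col_v cumsum c v.

Lemma antidiffD c c' : antidiff (c + c') = antidiff c + antidiff c'.
Proof. by apply/colP=> v; rewrite !mxE cumsum_additive. Qed.

Lemma cumsumMn c m t : cumsum (c *+ m) t = cumsum c t *+ m.
Proof.
elim: m => [|m IH]; last by rewrite !mulrS cumsum_additive IH.
by rewrite /cumsum big1 // => i _; rewrite /entry mulr0n mxE.
Qed.

Lemma antidiffMn c m : antidiff (c *+ m) = antidiff c *+ m.
Proof. by apply/colP=> v; rewrite mulmxnE !mxE cumsumMn. Qed.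

Lemma antidiff0 c : antidiff c ord0 ord0 = 0.
Proof. by rewrite mxE /cumsum big_ord0. Qed.

Lemma entry_antidiff c t : (t < n.+1)%N -> entry (antidiff c) t = cumsum c t.
Proof. by move=> tn; rewrite /entry mxE /= modn_small. Qed.

Lemma cumsum_inj c c' : antidiff c = antidiff c' -> cumsum c n.+1 = cumsum c' n.+1 -> c = c'.
Proof.
move=> e eN; apply/colP=> v; rewrite !entryE.
have E t : (t <= n.+1)%N -> cumsum c t = cumsum c' t.
  by rewrite leq_eqVlt => /predU1P[->//|tn]; rewrite -!entry_antidiff // e.
by apply: (addrI (cumsum c v)); rewrite -cumsumS E ?ltn_ord // E ?(ltnW (ltn_ord v)) // -cumsumS.
Qed.

(** Partial sums of c are periodic only up to the total of c. So reducing the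
    index d v modulo n costs floor(d v / n) times this total, and this is how
    Q_n enters the sandpile group. *)
Lemma antidiff_laplacian c :
  antidiff (L *m c) = dune_op d n *m antidiff c - cumsum c n.+1 *: carry d n.
Proof.
apply/colP=> v; rewrite mxE cumsum_laplacian [RHS]mxE [(_ *m _) _ _]entryE entry_dune_op.
rewrite entry_antidiff // -addrA; congr (_ + _).
rewrite [X in cumsum _ X](divn_eq _ n.+1) cumsum_period opprD addrC; congr (_ + _).
  by rewrite !mxE -mulr_natr natz.
by congr (- _); rewrite /entry mxE.
Qed.

Lemma total_laplacian c : cumsum (L *m c) n.+1 = 0.
Proof.
rewrite cumsum_laplacian -[(d * _)%N]addn0 cumsum_period.
by rewrite {3}/cumsum big_ord0 addr0 subrr.
Qed.

(** For b 0 = 0, the vector with partial sums b and total z. *)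
Definition difference (b : 'cV[int]_n.+1) (z : int) : 'cV[int]_n.+1 :=
  \col_v ((if v == ord_max then z else entry b v.+1) - entry b v).

Lemma entry_difference (b : 'cV[int]_n.+1) z t : (t < n.+1)%N ->
  entry (difference b z) t = (if t == n then z else entry b t.+1) - entry b t.
Proof. by move=> tn; rewrite /entry mxE -val_eqE /= modn_small. Qed.

Lemma cumsum_difference (b : 'cV[int]_n.+1) z t : b ord0 ord0 = 0 -> (t <= n)%N ->
  cumsum (difference b z) t = entry b t.
Proof.
move=> b0; elim: t => [|t IH] tn.
  by rewrite /cumsum big_ord0 entry0.
rewrite cumsumS IH ?(ltnW tn) // entry_difference ?ltnS ?(ltnW tn) //.
by rewrite (ltn_eqF tn) addrC subrK.
Qed.

Lemma antidiff_difference (b : 'cV[int]_n.+1) z : b ord0 ord0 = 0 -> antidiff (difference b z) = b.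
Proof.
move=> b0; apply/colP=> v; rewrite mxE cumsum_difference -?entryE //.
exact: ltn_ord v.
Qed.

Lemma total_difference (b : 'cV[int]_n.+1) z : b ord0 ord0 = 0 ->
  cumsum (difference b z) n.+1 = z.
Proof.
by move=> b0; rewrite cumsumS cumsum_difference // entry_difference // eqxx addrC subrK.
Qed.

Lemma laplacian_of_antidiff (c psi : 'cV[int]_n.+1) (j : int) :
    cumsum c n.+1 = 0 -> psi ord0 ord0 = 0 ->
    antidiff c = dune_op d n *m psi + j *: carry d n ->
  exists eta, c = L *m eta.
Proof.
move=> c0 psi0 e; exists (difference psi (- j)); apply: cumsum_inj.
  by rewrite antidiff_laplacian antidiff_difference // total_difference // scaleNr opprK.
by rewrite c0 total_laplacian.
Qed.

End Laplacian.

Section Sandpile.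
Variables n d : nat.
Hypothesis d_pr : prime d.
Local Notation L := (laplacian (DB n.+1 d)).
Local Notation C := (circulant_group1_group n.+1 d).
Local Notation Q := (Qn n.+1 d).

(** [dune_hom] sends [carry] to Q_n. So by [antidiff_laplacian] a vector of
    total 0 is in the image of the Laplacian exactly when its partial sums are
    sent to a power of Q_n. The torsion vectors modulo the Laplacian have total
    0, and all vectors of total 0 are torsion because C'(n,d) is finite. *)
Theorem sandpile_isog :
  zmod_isog (sandpile_group n.+1 d) (circulant_group1 n.+1 d / <[Q]>)%g.
Proof.
have [h [hD h0 hG hker hQ]] := dune_hom n d_pr.
have [U [V [uU uV UV]]] := tr_equivalent L.
have hC b : h b \in C.
  by rewrite h0; apply/hG; exists (zero_at0 b) => //; apply: zero_at0_0.
have nQ : C \subset 'N(<[Q]>)%g.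
  rewrite (subset_trans _ (cent_sub _)) // (subset_trans (abelian_circulant1 n d)) //.
  by rewrite centS // cycle_subG; apply: Qn_circulant_group1.
have hZ (z : int) : h (z *: carry d n) \in <[Q]>%g.
  case: z => m; rewrite ?NegzE ?scaleNr ?(additive_homN hD) ?groupV;
  by rewrite -natz scaler_nat (additive_homMn hD) hQ mem_cycle.
pose g (x : 'rV[int]_n.+1) := h (antidiff (U *m x^T)).
pose k x : coset_of <[Q]>%g := coset <[Q]> (g x).
have gD x y : g (x + y) = (g x * g y)%g.
  by rewrite /g linearD mulmxDr antidiffD hD.
have kD x y : k (x + y) = (k x * k y)%g.
  by rewrite /k gD morphM ?(subsetP nQ) // hC.
pose span := int_span [seq row v L | v : 'I_n.+1].
have spanU x w : U *m x^T = L *m w -> x \in span.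
  move=> e; apply/row_spanP; exists (invmx V *m w); rewrite -(mulKmx uU x^T) e.
  by rewrite -{1}(mulKVmx uV w) !mulmxA -[_ *m _ *m V]mulmxA -UV !mulmxA mulVmx // mul1mx.
have spanW x : x \in span -> exists w, U *m x^T = L *m w.
  by move=> /row_spanP[w ->]; exists (V *m w); rewrite !mulmxA UV.
have total0 x : torsion_mod [seq row v L | v : 'I_n.+1] x -> cumsum (U *m x^T) n.+1 = 0.
  move=> /asboolP[m m0 /spanW[w e]].
  apply/eqP; have := total_laplacian d_pr w; rewrite -e linearMn -scaler_nat -scalemxAr.
  by rewrite scaler_nat cumsumMn => /eqP; rewrite mulrn_eq0 gtn_eqF.
apply: (torsion_zquot_isog kD).
- move=> x /spanW[w e]; apply: coset_id; rewrite /g e antidiff_laplacian // hD.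
  rewrite groupMr; last by rewrite -scaleNr; apply: hZ.
  have -> : h (dune_op d n *m antidiff w) = 1%g.
    have w0 : (dune_op d n *m antidiff w) ord0 ord0 = 0.
      by rewrite dune_op0 // antidiff0 mul0rn.
    by apply: (proj2 (hker _ w0)); exists (antidiff w); rewrite ?antidiff0.
  exact: group1.
- move=> x tx kx; have : g x \in <[Q]>%g by apply: coset_idr; rewrite ?(subsetP nQ) ?hC.
  case/cycleP=> j gx; pose c := U *m x^T.
  have : h (antidiff c - j%:Z *: carry d n) = 1%g.
    apply/additive_homB => //; rewrite -natz scaler_nat (additive_homMn hD) hQ; exact: gx.
  case/hker=> [|psi psi0 e].
    by rewrite !mxE /cumsum big_ord0 muln0 div0n mulr0 subrr.
  have [eta ec] := @laplacian_of_antidiff n d d_pr c psi j (total0 x tx) psi0 (canRL (subrK _) e).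
  exact: spanU ec.
move=> y; split=> [/morphimP[z nz zC ->]|[x tx <-]]; last by rewrite mem_quotient ?hC.
have /hG[b b0 hb] := zC; pose c := difference b 0; pose x := (invmx U *m c)^T.
have Ux : U *m x^T = c by rewrite /x trmxK mulKVmx.
exists x; last by rewrite /k /g Ux antidiff_difference // hb.
(* The order of C kills h b, hence the class of x. *)
apply/asboolP; exists #|C|; first exact: cardG_gt0.
have : h (b *+ #|C|) = 1%g by rewrite (additive_homMn hD) hb expg_cardG.
case/hker=> [|psi psi0 e]; first by rewrite mulmxnE b0 mul0rn.
have [||eta ec] := @laplacian_of_antidiff n d d_pr (c *+ #|C|) psi 0 _ psi0 _.
- by rewrite cumsumMn total_difference // mul0rn.
- by rewrite antidiffMn antidiff_difference // e scale0r addr0.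
apply: (spanU _ eta); rewrite -ec -Ux linearMn -scaler_nat -scalemxAr.
by rewrite scaler_nat.
Qed.

End Sandpile.

Theorem theorem3p3 (n d : nat) (hn : (0 < n)%N) (hd : prime d) :
  zmod_isog (sandpile_group n d) (circulant_group1 n d / <[Qn n d]>)%g /\
  zmod_isog (sand_dune_group n d) (circulant_group1 n d).
Proof.
case: n hn => // n _; split; first exact: sandpile_isog.
exact: sand_dune_isog.
Qed.
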